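(* Let $R$ be a real closed field and let $V$ be an irreducible affine algebraic variety over $R$ whose function field $\mathcal{K}(V)$ is formally real, such that $\dim V\leq 2$. Then $\operatorname{Spec}_{pc}R[V]=\operatorname{Spec}_cR[V]$.
   Context: An affine algebraic variety over $R$ is $V=\operatorname{Spec}R[V]$ with coordinate ring $R[V]=R[x_1,\ldots,x_n]/I$, $I$ a radical ideal; if $V$ is irreducible, $A=R[V]$ is a domain with fraction field $\mathcal{K}(A)=\mathcal{K}(V)$. A cone of a ring $B$ is a subset $P\subset B$ with $P+P\subset P$, $P\cdot P\subset P$ and $b^2\in P$ for all $b\in B$; it is proper if $-1\notin P$. An ordering of $B$ is a proper cone $P$ such that $ab\in P$ implies $a\in P$ or $-b\in P$; $\operatorname{Spec}_rB$ is the set of orderings of $B$. For $\alpha\in\operatorname{Spec}_rA$, write $P_\alpha$ for the corresponding cone and $\operatorname{supp}(\alpha)=P_\alpha\cap -P_\alpha$; $a(\alpha)>0$ means $a\in P_\alpha\setminus\operatorname{supp}(\alpha)$. $\operatorname{Spec}_rA$ has the topology generated by the sets $\{\alpha\mid f_1(\alpha)>0,\ldots,f_k(\alpha)>0\}$, $f_i\in A$. The map $Q\mapsto Q\cap A$ identifies $\operatorname{Spec}_r\mathcal{K}(A)$ with the set of orderings of $A$ with support $(0)$; the set of central orderings is $\operatorname{Spec}_cA:=\overline{\operatorname{Spec}_r\mathcal{K}(A)}$ (closure in $\operatorname{Spec}_rA$). The set of precentral orderings is $\operatorname{Spec}_{pc}A=\{\alpha\in\operatorname{Spec}_rA\mid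 A\cap\sum\mathcal{K}(A)^2\subset P_\alpha\}$, where $\sum\mathcal{K}(A)^2$ is the set of sums of squares in $\mathcal{K}(A)$. *)

(* Defs.v *)
From HB Require Import structures.
From mathcomp Require Import all_boot all_algebra.
From mathcomp Require Import boolp classical_sets topology_structure.
From mathcomp Require Import mpoly.

Set Implicit Arguments.
Unset Strict Implicit.
Unset Printing Implicit Defensive.

Import GRing.Theory.
Local Open Scope classical_set_scope.
Local Open Scope ring_scope.

(* [prime_idealr] is the type of (proper) prime ideals: in an irreducible
   affine variety the radical ideal I is prime. *)
Definition coord_ring (R : rcfType) (n : nat)
  (I : prime_idealr {mpoly R[n]}) : Type := {ideal_quot I}.

(* MathComp only makes {ideal_quot I} a commutative ring; the domain structure
   required by {fraction _} needs (here, classically chosen) inverses of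
   units. *)
Section CoordRing.
Variables (R : rcfType) (n : nat) (I : prime_idealr {mpoly R[n]}).
Local Notation A := (coord_ring I).

HB.instance Definition _ := GRing.ComNzRing.on A.

Definition cr_unit : {pred A} := fun x => `[< exists y, y * x = 1 >].

Definition cr_inv (x : A) : A :=
  if pselect (exists y, y * x = 1) is left h then projT1 (cid h) else x.

Lemma cr_mulVx : {in cr_unit, left_inverse 1 cr_inv *%R}.
Proof.
move=> x /asboolP ux; rewrite /cr_inv; case: pselect => // h.
exact: (projT2 (cid h)).
Qed.

Lemma cr_unitPl (x y : A) : y * x = 1 -> cr_unit x.
Proof. by move=> yx; apply/asboolP; exists y. Qed.

Lemma cr_inv_out : {in [predC cr_unit], cr_inv =1 id}.
Proof. by move=> x /asboolPn nux; rewrite /cr_inv; case: pselect. Qed.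

HB.instance Definition _ :=
  GRing.ComNzRing_hasMulInverse.Build A cr_mulVx cr_unitPl cr_inv_out.

Lemma cr_integral : GRing.integral_domain_axiom A.
Proof. exact: Quotient.rquot_IdomainAxiom. Qed.

HB.instance Definition _ := GRing.ComUnitRing_isIntegral.Build A cr_integral.

End CoordRing.

Definition sums_of_squares (B : comNzRingType) : set B :=
  [set x | exists s : seq B, x = \sum_(y <- s) y ^+ 2].

Definition formally_real (B : comNzRingType) : Prop :=
  ~ sums_of_squares (- 1 : B).

Definition krull_dim_le (B : comNzRingType) (d : nat) : Prop :=
  forall (m : nat) (p : 'I_m.+1 -> prime_idealr B),
    (forall i j : 'I_m.+1, (i < j)%N ->
       {subset p i <= p j} /\ ~ {subset p j <= p i}) ->
    (m <= d)%N.

Definition is_cone (B : comNzRingType) (P : set B) : Prop :=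
  [/\ forall a b, P a -> P b -> P (a + b),
      forall a b, P a -> P b -> P (a * b) &
      forall b, P (b ^+ 2)].

Definition is_proper_cone (B : comNzRingType) (P : set B) : Prop :=
  is_cone P /\ ~ P (- 1).

Definition is_ordering (B : comNzRingType) (P : set B) : Prop :=
  is_proper_cone P /\ forall a b, P (a * b) -> P a \/ P (- b).

Record specr (B : comNzRingType) :=
  Specr { cone_of : set B; cone_ofP : is_ordering cone_of }.

Definition supp (B : comNzRingType) (alpha : specr B) : set B :=
  [set a | cone_of alpha a /\ cone_of alpha (- a)].

Definition pos_at (B : comNzRingType) (a : B) (alpha : specr B) : Prop :=
  cone_of alpha a /\ ~ supp alpha a.

Definition basic_open (B : comNzRingType) (fs : seq B) : set (specr B) :=
  [set alpha | forall f, f \in fs -> pos_at f alpha].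

HB.instance Definition _ (B : comNzRingType) := gen_eqMixin (specr B).
HB.instance Definition _ (B : comNzRingType) := gen_choiceMixin (specr B).
(* [isSubBaseTopological] wants a pointed index type. *)
HB.instance Definition _ (T : choiceType) := isPointed.Build (seq T) [::].
HB.instance Definition _ (B : comNzRingType) :=
  isSubBaseTopological.Build (specr B) [set: seq B] (@basic_open B).

Section Contraction.
Variable A : idomainType.
Local Notation K := {fraction A}.

Lemma contraction_subproof (Q : specr K) :
  is_ordering [set a : A | cone_of Q (tofrac a)].
Proof.
case: Q => Q [[[QD QM QX] Q1] QP] /=; split; first split; first split => /=.
- by move=> a b; rewrite rmorphD; apply: QD.
- by move=> a b; rewrite rmorphM; apply: QM.
- by move=> b; rewrite rmorphXn; apply: QX.
- by rewrite /= rmorphN rmorph1.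
- by move=> a b /=; rewrite rmorphM rmorphN; apply: QP.
Qed.

(* Q |-> Q \cap A, the map Spec_r K(A) -> Spec_r A *)
Definition contraction (Q : specr K) : specr A :=
  Specr (contraction_subproof Q).

Definition spec_c : set (specr A) := closure (range contraction).

Definition spec_pc : set (specr A) :=
  [set alpha | [set a : A | sums_of_squares (tofrac a)] `<=` cone_of alpha].

End Contraction.

Arguments spec_c A : clear implicits.
Arguments spec_pc A : clear implicits.

(* Main.v *)
Require Import Defs.
From HB Require Import structures.
From mathcomp Require Import all_boot all_algebra.
From mathcomp Require Import boolp classical_sets topology_structure.
From mathcomp Require Import mpoly.
From mathcomp Require Import finmap complex ring zify.

(** A sum of squares in the fraction field [K] of the coordinate ring [A] is
nonnegative at every ordering of [K], hence at every limit of such orderings, so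
central orderings are precentral.

For the converse let [alpha] be precentral with support [p].  If [p = 0], then
[alpha] is itself the contraction of an ordering of [K].  In general, by the
precentrality of [alpha], a principal open set [f > 0] containing [alpha] always
contains an ordering of [K]: otherwise [- f] would be a sum of squares in [K]
(lemma [pos_at_contraction]).  It remains to find principal neighbourhoods of
[alpha] inside the basic open sets [f1 > 0, ..., fk > 0], and by induction two
inequalities [f1 > 0, f2 > 0] have to be replaced by one (lemma [pos_at_pair]).

This is where [p <> 0] and [dim A <= 2] enter: they make [A / p] the ring of a
curve or of a point (lemma [curve_algebraic], by Zariski's lemma).  Once a
square root of [-1] is adjoined to the function field, the quadratic form
[<f1, f2, f1 f2>] is isotropic by Tsen's theorem (lemma [Tsen]); the real and
imaginary parts of an isotropic vector are two orthogonal vectors with the same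
value [F], which is positive at [alpha].  Comparing
determinants, [<f1, f2, f1 f2>] is isometric to [<F, F, 1>], so that [f1] and [f2]
have the form [s + t F] with [s] and [t] sums of squares in the function field of
[A / p].  Lifting these relations to [A] leaves an error term in [p], which is
absorbed by subtracting from [F] a square that vanishes at [alpha]
(lemma [pos_at_eliminate]).

Tsen's theorem is proved by counting: the coefficients of a vector of functions of
bounded degree are subject to fewer quadratic equations than there are
coefficients, and such a system has a nontrivial zero over an algebraically closed
field (lemma [Lang_Nagata]), by the Nullstellensatz and a comparison of the growth
of two spaces of polynomials. *)

Set Implicit Arguments.
Unset Strict Implicit.
Unset Printing Implicit Defensive.

Import GRing.Theory.
Local Open Scope classical_set_scope.
Local Open Scope ring_scope.

(** * Prime ideals and quotient domains *)

(** The empty chain is the only obstacle to the union form of Zorn's lemma here,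
so the empty set is added to the family. *)
Lemma Zorn_above (T : Type) (G : set (set T)) (J : set T) :
    G J -> J !=set0 ->
    (forall F : set (set T), F `<=` G -> F !=set0 -> total_on F subset ->
       G (\bigcup_(X in F) X)) ->
  exists A, G A /\ forall B, G B -> A `<=` B -> B `<=` A.
Proof.
move=> GJ [j Jj] Gchain.
have [|A [PA Amax]] := @Zorn_bigcup T [set A | G A \/ A = set0].
  move=> F FP totF.
  have [[X FX GX]|noG] := pselect (exists2 X, F X & G X); last first.
    right; rewrite -subset0 => x [X FX Xx].
    by case: (FP X FX) => [GX|X0]; [case: noG; exists X|rewrite X0 in Xx].
  left; rewrite (_ : \bigcup_(_ in _) _ = \bigcup_(Y in F `&` G) Y).
    apply: Gchain; first by move=> Y [].
      by exists X.
    by move=> Y Z [FY _] [FZ _]; apply: totF.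
  apply/seteqP; split=> x [Y]; last by case=> FY _ Yx; exists Y.
  move=> FY Yx; exists Y => //; split=> //.
  by case: (FP Y FY) => // Y0; rewrite Y0 in Yx.
have GA : G A.
  case: PA => // A0; case: (Amax J); last by left.
  by rewrite A0; split=> // /(_ j Jj).
exists A; split=> // B GB AB x Bx; apply: contrapT => nAx.
by apply: (Amax B); [split=> // /(_ x Bx)|left].
Qed.

(** Subsets rather than boolean predicates: the ideals below come from Zorn's
lemma and from supports of orderings, where membership is not decidable. *)
Record is_ideal (B : comNzRingType) (J : set B) : Prop := IsIdeal {
  ideal0 : J 0;
  idealD : forall x y, J x -> J y -> J (x + y);
  idealM : forall a x, J x -> J (a * x) }.

Record is_prime (B : comNzRingType) (P : set B) : Prop := IsPrime {
  prime_ideal : is_ideal P;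
  prime1 : ~ P 1;
  primeM : forall x y, P (x * y) -> P x \/ P y }.

Section PrimeOfSet.
Variables (B : comNzRingType) (P : set B) (Pprime : is_prime P).

Definition pred_of_prime of is_prime P : B -> bool := fun x => `[< P x >].
Local Notation S := (pred_of_prime Pprime).

Lemma pred_of_prime_idealr : idealr_closed S.
Proof.
have [[P0 PD PM] P1 _] := Pprime; split.
- exact/asboolP.
- exact/asboolPn.
- by move=> a u v /asboolP Pu /asboolP Pv; apply/asboolP/PD => //; apply: PM.
Qed.

Lemma pred_of_prime_prime : prime_idealr_closed S.
Proof.
have [_ _ PM] := Pprime; move=> u v /asboolP /PM [Pu|Pv]; apply/orP.
  by left; apply/asboolP.
by right; apply/asboolP.
Qed.

HB.instance Definition _ := isIdealr.Build B S pred_of_prime_idealr.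
HB.instance Definition _ := isPrimeIdealrClosed.Build B S pred_of_prime_prime.

Lemma prime_idealr_of_set : exists Q : prime_idealr B, forall x, x \in Q <-> P x.
Proof. by exists S => x; split => /asboolP. Qed.

End PrimeOfSet.

Section QuotientDomain.
Variables (B : comNzRingType) (I : prime_idealr B).

(** Same carrier as the quotient ring, with classically chosen inverses of units so
that it becomes an integral domain. *)
Definition prime_quot : Type := {ideal_quot I}.
Local Notation A := prime_quot.

HB.instance Definition _ := GRing.ComNzRing.on A.

Definition pq_unit : {pred A} := fun x => `[< exists y, y * x = 1 >].

Definition pq_inv (x : A) : A :=
  if pselect (exists y, y * x = 1) is left h then projT1 (cid h) else x.

Lemma pq_mulVx : {in pq_unit, left_inverse 1 pq_inv *%R}.
Proof.
move=> x /asboolP ux; rewrite /pq_inv; case: pselect => // h.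
exact: (projT2 (cid h)).
Qed.

Lemma pq_unitPl (x y : A) : y * x = 1 -> pq_unit x.
Proof. by move=> yx; apply/asboolP; exists y. Qed.

Lemma pq_inv_out : {in [predC pq_unit], pq_inv =1 id}.
Proof. by move=> x /asboolPn nux; rewrite /pq_inv; case: pselect. Qed.

HB.instance Definition _ :=
  GRing.ComNzRing_hasMulInverse.Build A pq_mulVx pq_unitPl pq_inv_out.

Lemma pq_integral : GRing.integral_domain_axiom A.
Proof. exact: Quotient.rquot_IdomainAxiom. Qed.

HB.instance Definition _ := GRing.ComUnitRing_isIntegral.Build A pq_integral.

End QuotientDomain.

Lemma prime_quotient (B : comNzRingType) (P : set B) : is_prime P ->
  exists (T : idomainType) (f : {rmorphism B -> T}),
    (forall y, exists x, f x = y) /\ (forall x, f x = 0 <-> P x).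
Proof.
move=> /prime_idealr_of_set [Q QP].
pose f : {rmorphism B -> prime_quot Q} := (\pi_({ideal_quot Q}))%qT.
exists (prime_quot Q), f; split=> [y|x]; first by exists (repr y); exact: reprK.
have QE : (x - 0 \in Q) = (f x == f 0) by exact: Quotient.idealrBE.
rewrite -QP -[X in X \in Q]subr0 QE rmorph0.
by split=> [->|/eqP].
Qed.

(** Maximality among the ideals disjoint from [M] gives more than primality: every
element outside [P] divides an element of [M] modulo [P].  For [M] the powers of
an element, or the nonzero elements of a subring, this makes the quotient a
field after inverting [M], which is how Zariski's lemma applies to it. *)
Lemma prime_avoiding (B : comNzRingType) (J M : set B) :
    is_ideal J -> M 1 -> (forall x y, M x -> M y -> M (x * y)) ->
    (forall x, J x -> ~ M x) ->
  exists P : set B, [/\ is_prime P, J `<=` P, forall x, P x -> ~ M x &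
    forall x, ~ P x -> exists a m, M m /\ P (a * x - m)].
Proof.
move=> Jid M1 MM JM.
pose G := [set A : set B | [/\ is_ideal A, J `<=` A & forall x, A x -> ~ M x]].
have [| | |P [[Pid JP PM] Pmax]] := @Zorn_above B G J.
- by split.
- by exists 0; apply: ideal0.
- move=> F FG [X0 FX0] totF; split.
  + split; first by exists X0 => //; case: (FG _ FX0) => -[].
      move=> x y [X FX Xx] [Y FY Yy]; case: (totF X Y FX FY) => [XY|YX].
        by exists Y => //; case: (FG _ FY) => Yid _ _; apply: idealD => //; apply: XY.
      by exists X => //; case: (FG _ FX) => Xid _ _; apply: idealD => //; apply: YX.
    by move=> a x [X FX Xx]; exists X => //; case: (FG _ FX) => Xid _ _; apply: idealM.
  + by move=> x Jx; exists X0 => //; case: (FG _ FX0) => _ JX0 _; apply: JX0.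
  + by move=> x [X FX Xx]; case: (FG _ FX) => _ _; apply.
have Pout x : ~ P x -> exists a m, M m /\ P (a * x - m).
  move=> nPx; apply: contrapT => no.
  pose Px := [set y | exists a, P (a * x - y)].
  have PPx : P `<=` Px.
    by move=> y Py; exists 0; rewrite mul0r -mulN1r addrC addr0; apply: idealM.
  apply: nPx; apply: (Pmax Px) => //; last first.
    by exists 1; rewrite mul1r subrr; apply: ideal0.
  split; [split| |].
  - exact/PPx/(ideal0 Pid).
  - move=> y z [a Pa] [b Pb]; exists (a + b).
    rewrite (_ : _ - _ = (a * x - y) + (b * x - z)); last by ring.
    exact: idealD.
  - move=> c y [a Pa]; exists (c * a).
    by rewrite -mulrA -mulrBr; apply: idealM.
  - by move=> y /JP /PPx.
  - by move=> y [a Pa] My; apply: no; exists a, y.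
exists P; split=> //; split=> //; first by move=> /PM.
move=> x y Pxy; have [|nPx] := pselect (P x); first by left.
have [|nPy] := pselect (P y); first by right.
have [a [m [Mm Pa]]] := Pout x nPx; have [b [n [Mn Pb]]] := Pout y nPy.
case: (PM (m * n)); last exact: MM.
rewrite (_ : m * n = (a * b) * (x * y) + (- (b * y)) * (a * x - m) + (- m) * (b * y - n));
  last by ring.
by apply: idealD => //; [apply: idealD => //|]; apply: idealM.
Qed.

(** * Zariski's lemma *)

Definition ev (A B : comNzRingType) (c : {rmorphism A -> B}) (y : B) :
  {rmorphism {poly A} -> B} := horner_morph (fun x => mulrC y (c x)).

Lemma evE (A B : comNzRingType) (c : {rmorphism A -> B}) y p :
  ev c y p = (map_poly c p).[y].
Proof. by []. Qed.

Lemma evC (A B : comNzRingType) (c : {rmorphism A -> B}) y a : ev c y a%:P = c a.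
Proof. exact: horner_morphC. Qed.

Lemma evX (A B : comNzRingType) (c : {rmorphism A -> B}) y : ev c y 'X = y.
Proof. exact: horner_morphX. Qed.

(** The coefficients are mapped before asking for a nonzero polynomial, since [c]
need not be injective: [c] will often be evaluation at an algebraic element. *)
Definition algebraic_over (A B : comNzRingType) (c : {rmorphism A -> B}) (y : B) :=
  exists p : {poly A}, map_poly c p != 0 /\ ev c y p = 0.

(** Quantifying over all subrings makes adjoining one generator at a time, as in
[generates_cons], immediate. *)
Definition generates (A B : comNzRingType) (c : {rmorphism A -> B}) (ys : seq B) :=
  forall S : set B, (forall x y, S x -> S y -> S (x + y)) ->
    (forall x y, S x -> S y -> S (x * y)) -> (forall a, S (c a)) ->
    (forall y, y \in ys -> S y) -> forall x, S x.

Lemma generates_cons (A B : comNzRingType) (c : {rmorphism A -> B}) y ys :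
  generates c (y :: ys) -> generates (ev c y) ys.
Proof.
move=> gen S SD SM Sc Sys; apply: gen => // [a|z].
  by rewrite -(evC c y); apply: Sc.
by rewrite inE => /predU1P[->|/Sys//]; rewrite -(evX c y).
Qed.

Lemma generates_ev (A B : comNzRingType) (c : {rmorphism A -> B}) y ys :
  generates c ys -> generates (ev c y) ys.
Proof.
move=> gen; apply: generates_cons => S SD SM Sc Sys; apply: gen => // z zys.
by apply: Sys; rewrite inE zys orbT.
Qed.

Lemma generates_image (A B T : comNzRingType) (c : {rmorphism A -> B})
    (f : {rmorphism B -> T}) (ys : seq B) :
  (forall z, exists y, f y = z) -> generates c ys -> generates (f \o c) (map f ys).
Proof.
move=> fsurj gen S SD SM Sc SX z; have [y <-] := fsurj z.
apply: (gen (fun y => S (f y))) => [y1 y2|y1 y2|a|x xys].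
- by rewrite rmorphD; apply: SD.
- by rewrite rmorphM; apply: SM.
- exact: Sc.
- by apply: SX; apply: map_f.
Qed.

Section Goldman.
Variable T : idomainType.

(** The image of [A] becomes a field once [c s] and the elements of [M] are
inverted. *)
Definition units_up_to (A : comNzRingType) (c : {rmorphism A -> T}) (M : set T)
    (s : A) :=
  c s != 0 /\ forall x, c x != 0 ->
    exists z n m, M m /\ c (x * z) = c s ^+ n * m.

Section Step.
Variables (A : comNzRingType) (c : {rmorphism A -> T}) (M : set T).
Hypotheses (M1 : M 1) (MM : forall x y, M x -> M y -> M (x * y)).
Hypotheses (M0 : ~ M 0) (MA : forall m, M m -> exists a, c a = m).

(** Were [y] transcendental, [A][y] would be a polynomial ring over the image of
[A]; there [1 + y s] is prime to [s], so it can divide [s ^+ n * m] only if it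
divides the constant [m], which its degree forbids. *)
Lemma algebraic_of_units_up_to y s : units_up_to (ev c y) M s -> algebraic_over c y.
Proof.
move=> [s0 Hs]; apply: contrapT => nalg.
have tr p : map_poly c p != 0 -> ev c y p != 0.
  by move=> p0; apply: contra_notN nalg => /eqP p1; exists p.
pose s' := map_poly c s.
have s'0 : s' != 0 by apply: contraNneq s0 => s0; rewrite evE -/s' s0 horner0.
have szx : (1 < size (1 + 'X * s')%R)%N.
  rewrite addrC size_polyDl.
    by rewrite mulrC size_mulX // ltnS size_poly_gt0.
  by rewrite mulrC size_mulX // size_poly1 ltnS size_poly_gt0.
have mapx : map_poly c (1 + 'X * s) = 1 + 'X * s'.
  by rewrite rmorphD rmorphM rmorph1 /= map_polyX.
have [|z [n [m [Mm E]]]] := Hs (1 + 'X * s).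
  by apply: tr; rewrite mapx -size_poly_gt0 ltnW.
have [a ca] := MA Mm.
have a0 : c a != 0 by apply: contra_notN M0 => /eqP a0; rewrite -a0 ca.
have {E} : map_poly c ((1 + 'X * s) * z - s ^+ n * a%:P) == 0.
  apply: contraT => /tr; rewrite rmorphB E rmorphM rmorphXn /= evC ca subrr.
  by rewrite eqxx.
rewrite rmorphB rmorphM [X in X * _]mapx rmorphM rmorphXn /= map_polyC -/s'.
rewrite subr_eq0 => /eqP E.
set P := 1 + 'X * s' in szx E.
have [q Eq] : exists q, (P - 1) ^+ n = P * q + (- 1) ^+ n.
  elim: n {E} => [|k [q IH]]; first by exists 0; rewrite mulr0 add0r !expr0.
  exists (q * (P - 1) + (-1) ^+ k); rewrite !exprSr IH; ring.
have {}Eq : P * ('X^n * map_poly c z - q * (c a)%:P) = ((- 1) ^+ n * c a)%:P.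
  have XP : (P - 1) ^+ n = 'X^n * s' ^+ n.
    by rewrite -exprMn; congr (_ ^+ n); rewrite /P; ring.
  have : 'X^n * (P * map_poly c z) = (P - 1) ^+ n * (c a)%:P.
    by rewrite E XP mulrA.
  rewrite Eq [RHS]mulrDl => {}E.
  rewrite mulrBr mulrCA E polyCM rmorphXn /= rmorphN1; ring.
have [w0|w0] := eqVneq ('X^n * map_poly c z - q * (c a)%:P) 0.
  move/eqP: Eq; rewrite w0 mulr0 eq_sym polyC_eq0 mulf_eq0 (negPf a0) orbF.
  by rewrite expf_eq0 oppr_eq0 oner_eq0 andbF.
have := size_polyC_leq1 ((- 1) ^+ n * c a).
rewrite -Eq size_mul //; last by rewrite -size_poly_gt0 ltnW.
rewrite leqNgt; apply/negP; rewrite negbK.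
move: szx w0; rewrite -size_poly_gt0.
case: (size P) => [|[|k]] //; case: (size _) => // l _ _.
by rewrite addSn addnS.
Qed.


Lemma integral_lead (p : {poly A}) (y : T) :
  (map_poly c p).[y] = 0 -> integralOver c (lead_coef (map_poly c p) * y).
Proof.
move=> py; set q := map_poly c p in py *.
have [->|q0] := eqVneq q 0.
  by rewrite lead_coef0 mul0r; apply: integral0.
have [k szq] : exists k, size q = k.+1.
  by exists (size q).-1; rewrite prednK // size_poly_gt0.
have leadq : lead_coef q = c p`_k by rewrite lead_coefE szq coef_map.
have k0 : (0 < k)%N.
  case: k szq leadq => // szq _; move: py q0; rewrite (size1_polyC (eq_leq szq)).
  by rewrite hornerC => ->; rewrite eqxx.
pose r : {poly A} := 'X^k + \poly_(i < k) (p`_i * p`_k ^+ (k.-1 - i)).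
exists r.
  rewrite monicE lead_coefDl ?lead_coefXn // size_polyXn.
  exact: leq_trans (size_poly _ _) _.
have mapr : map_poly c (\poly_(i < k) (p`_i * p`_k ^+ (k.-1 - i))) =
    \poly_(i < k) (c p`_i * c p`_k ^+ (k.-1 - i)).
  apply/polyP=> i; rewrite coef_map !coef_poly; case: ifP => _.
    by rewrite -[LHS]/(c _) rmorphM rmorphXn.
  exact: rmorph0.
rewrite rootE rmorphD /= map_polyXn mapr hornerD hornerXn horner_poly leadq.
have -> : \sum_(i < k) c p`_i * c p`_k ^+ (k.-1 - i) * (c p`_k * y) ^+ i =
    c p`_k ^+ k.-1 * \sum_(i < k) c p`_i * y ^+ i.
  rewrite mulr_sumr; apply: eq_bigr => i _; rewrite exprMn.
  have -> : c p`_k ^+ k.-1 = c p`_k ^+ (k.-1 - i) * c p`_k ^+ i.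
    by rewrite -exprD subnK // -ltnS prednK.
  by ring.
move: py; rewrite horner_coef szq big_ord_recr /= /q coef_map.
under eq_bigr do rewrite coef_map.
move/eqP; rewrite addr_eq0 => /eqP ->.
by rewrite exprMn mulrN mulrA -exprSr prednK // subrr.
Qed.


Lemma integral_exp (y : T) n : integralOver c y -> integralOver c (y ^+ n).
Proof.
move=> inty; elim: n => [|n IH]; first by rewrite expr0; apply: integral1.
by rewrite exprS; apply: integral_mul.
Qed.

Lemma integral_denominator (y : T) (a : A) (z : {poly A}) :
  integralOver c (c a * y) -> integralOver c (c a ^+ size z * ev c y z).
Proof.
move=> intay; rewrite evE (horner_coef_wide _ (size_poly _ _)) mulr_sumr.
apply: (big_ind (integralOver c)) => [|u v|i _].
- exact: integral0.
- exact: integral_add.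
have -> : c a ^+ size z = c a ^+ (size z - i) * c a ^+ i.
  by rewrite -exprD subnK // ltnW.
rewrite coef_map.
have -> : c a ^+ (size z - i) * c a ^+ i * (c z`_i * y ^+ i) =
    (c a ^+ (size z - i) * c z`_i) * (c a * y) ^+ i by rewrite exprMn; ring.
apply: integral_mul; last exact: integral_exp.
by apply: integral_mul; last exact: integral_id; apply/integral_exp/integral_id.
Qed.

(** Dividing a monic equation of [y] by the power of the variable that it contains
leaves a nonzero constant term [b], a multiple of [y] by an integral element. *)
Lemma integral_cofactor (y : T) : y != 0 -> integralOver c y ->
  exists e b, [/\ integralOver c e, c b != 0 & y * e = c b].
Proof.
have evXC q b : (map_poly c (q * 'X + b%:P)).[y] = (map_poly c q).[y] * y + c b.
  by rewrite rmorphD rmorphM /= map_polyX map_polyC hornerMXaddC.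
move=> y0 [p]; elim/poly_ind: p => [|q b IH].
  by rewrite monicE lead_coef0 eq_sym oner_eq0.
rewrite rootE evXC.
have [->|q0] := eqVneq q 0.
  rewrite mul0r add0r monicE lead_coefC => /eqP->.
  by rewrite rmorph0 horner0 mul0r add0r rmorph1 oner_eq0.
rewrite monicE lead_coefDl; last first.
  by rewrite size_mulX // ltnS (leq_trans (size_polyC_leq1 _)) // size_poly_gt0.
rewrite lead_coefMX -monicE => qm.
have [->|cb] := eqVneq (c b) 0.
  by rewrite addr0 mulf_eq0 (negPf y0) orbF => qy; apply: IH.
rewrite addrC addr_eq0 => /eqP E; exists (- (map_poly c q).[y]), b; split=> //.
  apply/integral_opp/integral_horner.
    by apply/integral_poly => i; rewrite coef_map; apply: integral_id.
  exists (q * 'X + b%:P).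
    rewrite monicE lead_coefDl ?lead_coefMX -?monicE //.
    by rewrite size_mulX // ltnS (leq_trans (size_polyC_leq1 _)) // size_poly_gt0.
  by rewrite rootE evXC E addrN.
by rewrite E mulrN mulrC.
Qed.

(** Multiplying the equation of [y] by a power of [x] clears [y]: this is the
argument by which a subring over which a field is integral is a field. *)
Lemma integral_dvd (y : T) (x w : A) : integralOver c y -> c x * y = c w ->
  exists z k, c (x * z) = c w ^+ k.
Proof.
move=> [p /monicP pm]; rewrite rootE => /eqP py xy.
have [k szp] : exists k, size p = k.+1.
  exists (size p).-1; rewrite prednK // size_poly_gt0.
  by apply/eqP => p0; move/eqP: pm; rewrite p0 lead_coef0 eq_sym oner_eq0.
have pk : p`_k = 1 by rewrite -pm lead_coefE szp.
have : c w ^+ k + \sum_(i < k) c x ^+ (k - i) * c p`_i * c w ^+ i = 0.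
  transitivity (c x ^+ k * (map_poly c p).[y]); last by rewrite py mulr0.
  rewrite (@horner_coef_wide _ k.+1); last by rewrite -szp; apply: size_poly.
  rewrite big_ord_recr /= coef_map pk [X in X * y ^+ k](rmorph1 c) mul1r addrC.
  rewrite mulrDr -exprMn xy mulr_sumr; congr (_ + _); apply: eq_bigr => i _.
  rewrite coef_map -xy exprMn.
  have -> : c x ^+ k = c x ^+ (k - i) * c x ^+ i.
    by rewrite -exprD subnK // ltnW.
  by ring.
move/eqP; rewrite addr_eq0 => /eqP wk.
exists (- \sum_(i < k) x ^+ (k - i).-1 * p`_i * w ^+ i), k.
rewrite wk mulrN rmorphN mulr_sumr rmorph_sum; congr (- _); apply: eq_bigr => i _.
rewrite !rmorphM !rmorphXn !mulrA -exprS prednK // subn_gt0 //.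
Qed.

(** With [a] the leading coefficient of an equation of [y] and [b] the constant
term of an equation of the localizing element, everything becomes integral over
[A] after multiplication by a power of [a * b]; integrality then brings the
quotients back into [A]. *)
Lemma units_up_to_descent y s : units_up_to (ev c y) M s ->
  exists s', units_up_to c M s'.
Proof.
move=> us; have [p [p0 py]] := algebraic_of_units_up_to us.
have [a Ea] : exists a, c a = lead_coef (map_poly c p).
  by exists p`_(size (map_poly c p)).-1; rewrite lead_coefE coef_map.
have ca : c a != 0 by rewrite Ea lead_coef_eq0.
have intay : integralOver c (c a * y) by rewrite Ea; apply: integral_lead.
have [s0 Hs] := us.
have [|e [b [inte cb te]]] :=
    integral_cofactor _ (integral_denominator s intay).
  by rewrite mulf_neq0 // expf_neq0.
exists (a * b); split; first by rewrite rmorphM mulf_neq0.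
move=> x cx; have [|z [n [m [Mm E]]]] := Hs x%:P; first by rewrite evC.
have [mu Emu] := MA Mm.
pose d := size s; pose N := (size z + n)%N.
rewrite rmorphM evC in E.
have [||z' [k Ez]] := @integral_dvd
   (c (a ^+ n * b ^+ size z) * (c a ^+ size z * ev c y z) *
     (c a ^+ d * e) ^+ n) x ((a * b) ^+ N * mu).
- apply: integral_mul; last first.
    apply/integral_exp/integral_mul => //; apply/integral_exp/integral_id.
  by apply: integral_mul; [apply: integral_id|apply: integral_denominator].
- rewrite -/d; set g := c a ^+ d * e.
  have cbn : c b ^+ n = g ^+ n * ev c y s ^+ n.
    by rewrite -exprMn -te; congr (_ ^+ _); rewrite -/d /g; ring.
  rewrite !rmorphM !rmorphXn Emu /N rmorphM !exprD [in RHS]exprMn.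
  rewrite [X in _ * X * m]exprMn cbn.
  transitivity (c a ^+ n * c b ^+ size z * c a ^+ size z * g ^+ n *
    (c x * ev c y z)); first by ring.
  by rewrite E; ring.
exists z', (N * k)%N, (m ^+ k); split.
  by elim: k {Ez} => // k IH; rewrite exprS; apply: MM.
by rewrite Ez rmorphM Emu rmorphXn exprMn exprM.
Qed.


End Step.

Lemma units_up_to_generates (M : set T) (ys : seq T) (s0 : T) :
    M 1 -> (forall x y, M x -> M y -> M (x * y)) -> ~ M 0 -> s0 != 0 ->
    (forall x, x != 0 -> exists z n m, M m /\ x * z = s0 ^+ n * m) ->
  forall (A : comNzRingType) (c : {rmorphism A -> T}),
    (forall m, M m -> exists a, c a = m) -> generates c ys ->
  exists s, units_up_to c M s.
Proof.
move=> M1 MM M0 s00 Hs; elim: ys => [|y ys IH] A c MA gen; last first.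
  have [|s us] := IH _ (ev c y) _ (generates_cons gen).
    by move=> m /MA [a <-]; exists a%:P; rewrite evC.
  exact: units_up_to_descent us.
have csurj x : exists a, c a = x.
  apply: (gen (fun x => exists a, c a = x)) => // [_ _ [a <-] [b <-]|
    _ _ [a <-] [b <-]|a].
  - by exists (a + b); rewrite rmorphD.
  - by exists (a * b); rewrite rmorphM.
  - by exists a.
have [s cs] := csurj s0; exists s; split; first by rewrite cs.
move=> x /Hs [z [n [m [Mm E]]]]; have [z' cz] := csurj z.
by exists z', n, m; rewrite rmorphM cs cz.
Qed.

End Goldman.

(** Adjoin [u] to [D] first, remove the generators [ys] one by one with
[units_up_to_descent], and apply [algebraic_of_units_up_to] to [D][u].  With
[D] a field and [s0 = 1] this is the usual statement; a domain [D] and a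
localizing element [s0] come for free and are what the applications need. *)
Lemma Zariski_lemma (D : idomainType) (T : idomainType) (f : {rmorphism D -> T})
    (ys : seq T) (s0 : T) :
    injective f -> generates f ys -> s0 != 0 ->
    (forall x, x != 0 -> exists z n d, d != 0 /\ x * z = s0 ^+ n * f d) ->
  forall u, algebraic_over f u.
Proof.
move=> finj gen s00 Hs u; pose M := [set m | exists2 d, d != 0 & f d = m].
have M1 : M 1 by exists 1; rewrite ?oner_neq0 ?rmorph1.
have MM x y : M x -> M y -> M (x * y).
  by move=> [d d0 <-] [e e0 <-]; exists (d * e); rewrite ?mulf_neq0 ?rmorphM.
have M0 : ~ M 0.
  by move=> [d d0 fd]; case/eqP: d0; apply: finj; rewrite fd rmorph0.
have MD m : M m -> exists d, f d = m by move=> [d _ <-]; exists d.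
have [|||s us] := @units_up_to_generates T M ys s0 M1 MM M0 s00 _ _ (ev f u).
- by move=> x /Hs [z [n [d [d0 E]]]]; exists z, n, (f d); split=> //; exists d.
- by move=> m /MD [d <-]; exists d%:P; rewrite evC.
- exact: generates_ev.
exact: algebraic_of_units_up_to us.
Qed.

(** * Systems of quadratic forms over an algebraically closed field *)

Lemma linear_dependence (F : fieldType) (I J : finType) (M : I -> J -> F) :
    (#|J| < #|I|)%N ->
  exists l : I -> F, (exists i, l i != 0) /\ forall j, \sum_i l i * M i j = 0.
Proof.
move=> ltJI; pose A := \matrix_(i < #|I|, j < #|J|) M (enum_val i) (enum_val j).
have : kermx A != 0.
  rewrite kermx_eq0; apply: contraTN ltJI => /eqP rA.
  by rewrite -leqNgt -rA rank_leq_col.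
case/rowV0Pn => v /sub_kermxP vA /rV0Pn [k vk].
exists (fun i => v 0 (enum_rank i)); split; first by exists (enum_val k); rewrite enum_valK.
move=> j; have /matrixP/(_ 0 (enum_rank j)) := vA; rewrite !mxE => {2}<-.
rewrite [RHS](reindex (@enum_rank I)) /=; last exact/onW_bij/enum_rank_bij.
by apply: eq_bigr => i _; rewrite !mxE !enum_rankK.
Qed.

Lemma mpoly_generates (C : comNzRingType) (s : nat) :
  generates (mpolyC s (R := C)) [seq 'X_i | i : 'I_s].
Proof.
move=> S SD SM Sc SX p; rewrite [p]mpolyE; apply: (big_ind S) => [||m _].
- by rewrite -(mpolyC0 s); apply: Sc.
- exact: SD.
rewrite -mul_mpolyC; apply: (SM); first exact: Sc.
rewrite mpolyXE_id; apply: (big_ind S) => [||i _].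
- by rewrite -(mpolyC1 s); apply: Sc.
- exact: SM.
elim: (m i) => [|k IH]; first by rewrite expr0 -(mpolyC1 s); apply: Sc.
by rewrite exprS; apply: SM => //; apply: SX; apply: map_f; rewrite mem_enum.
Qed.

Section Nullstellensatz.
Variables (C : closedFieldType) (s : nat).

Definition comb (r : nat) (Q : 'I_r -> {mpoly C[s]}) : set {mpoly C[s]} :=
  [set p | exists g : 'I_r -> {mpoly C[s]}, p = \sum_j g j * Q j].

Lemma comb_ideal r (Q : 'I_r -> {mpoly C[s]}) : is_ideal (comb Q).
Proof.
split; first by exists (fun=> 0); rewrite big1 // => j _; rewrite mul0r.
  move=> _ _ [g ->] [h ->]; exists (fun j => g j + h j).
  by rewrite -big_split; apply: eq_bigr => j _; rewrite mulrDl.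
move=> a _ [g ->]; exists (fun j => a * g j).
by rewrite mulr_sumr; apply: eq_bigr => j _; rewrite mulrA.
Qed.

(** A prime ideal containing the [Q j] and maximal among the ideals avoiding the
powers of ['X_i] has a residue ring algebraic over [C], hence equal to [C]: the
residues of the variables are the coordinates of a zero. *)
Lemma Nullstellensatz_coordinate r (Q : 'I_r -> {mpoly C[s]}) (i : 'I_s) :
    (forall N, ~ comb Q ('X_i ^+ N)) ->
  exists v : 'I_s -> C, v i != 0 /\ forall j, (Q j).@[v] = 0.
Proof.
move=> nX; pose M := [set p : {mpoly C[s]} | exists N, p = 'X_i ^+ N].
have [||| P [Pprime QP PM Pmax]] := @prime_avoiding _ (comb Q) M (comb_ideal Q).
- by exists 0%N; rewrite expr0.
- by move=> _ _ [k ->] [l ->]; exists (k + l)%N; rewrite exprD.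
- by move=> x Jx [N xN]; apply: (nX N); rewrite -xN.
have [T [pr [prsurj prker]]] := prime_quotient Pprime.
pose f : {rmorphism C -> T} := pr \o @mpolyC s C.
have finj : injective f by apply: fmorph_inj.
have gen : generates f (map pr [seq 'X_i | i : 'I_s]).
  exact: generates_image prsurj (@mpoly_generates C s).
have Xi0 : pr 'X_i != 0.
  by apply/eqP => /prker /PM; apply; exists 1%N; rewrite expr1.
have alg : forall u, algebraic_over f u.
  apply: (Zariski_lemma finj gen Xi0) => x x0.
  have [p px] := prsurj x.
  have [|a [m [[N mN] Pa]]] := Pmax p.
    by move=> /prker px0; rewrite -px px0 eqxx in x0.
  exists (pr a), N, 1; split; first exact: oner_neq0.
  rewrite rmorph1 mulr1 -rmorphXn -px -rmorphM mulrC; apply/eqP.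
  by rewrite -subr_eq0 -rmorphB -mN; apply/eqP/prker.
have fsurj u : exists z, u = f z.
  have [p [p0]] := alg u; rewrite evE.
  have [zs ->] := closed_field_poly_normal p.
  rewrite map_polyZ /= hornerZ => /eqP; rewrite mulf_eq0.
  have : f (lead_coef p) != 0.
    by apply: contraNneq p0 => l0; rewrite -lead_coef_eq0 lead_coef_map l0.
  move=> /negPf ->; rewrite orFb map_prod_XsubC -(big_map f predT (fun z => 'X - z%:P)).
  by rewrite -/(root _ _) root_prod_XsubC => /mapP [z _ ->]; exists z.
have [v Ev] : exists v : 'I_s -> C, forall k, pr 'X_k = f (v k).
  exists (fun k => projT1 (cid (fsurj (pr 'X_k)))) => k.
  exact: (projT2 (cid (fsurj (pr 'X_k)))).
have prE p : pr p = f p.@[v].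
  rewrite {1}[p]mpolyE mevalE !rmorph_sum; apply: eq_bigr => m _.
  rewrite -mul_mpolyC !rmorphM mpolyXE_id !rmorph_prod /=; congr (_ * _).
  by apply: eq_bigr => k _; rewrite !rmorphXn Ev.
exists v; split; first by apply: contraNneq Xi0 => v0; rewrite Ev v0 rmorph0.
move=> j; apply: finj; rewrite -prE rmorph0; apply/prker/QP.
exists (fun k => (k == j)%:R); rewrite (bigD1 j) //= eqxx mul1r big1 ?addr0 //.
by move=> k /negPf ->; rewrite mul0r.
Qed.

End Nullstellensatz.

Section LangNagata.
Variables (C : closedFieldType) (s r : nat) (Q : 'I_r -> {mpoly C[s]}).
Hypothesis Qhomog : forall j, Q j \is 2.-homog.

Lemma pihomogM d (g q : {mpoly C[s]}) : q \is 2.-homog ->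
  pihomog mdeg d.+2 (g * q) = pihomog mdeg d g * q.
Proof.
move=> qh; have hom k : pihomog mdeg k g * q \is k.+2.-homog.
  by rewrite -addn2; apply: dhomogM => //; apply: pihomogP.
pose K := maxn (mmeasure mdeg g) d.+1.
rewrite {1}(@pihomog_partitionE _ _ mdeg K g) ?leq_maxl // mulr_suml linear_sum.
have dK : (d < K)%N by rewrite leq_maxr.
rewrite (bigD1 (Ordinal dK)) //= big1 => [|k kd]; last first.
  apply: (@pihomog_ne0 _ _ _ k.+2); last exact: hom.
  rewrite -[_.+2 == _]/(k == d :> nat); by apply: contraNneq kd => kd; apply/eqP/val_inj.
by rewrite addr0 pihomog_dE.
Qed.

(** The linear span of the monomials with exponents below [D] times the products
of powers at most [d] of the forms [Q j]. *)
Definition spanned (d D : nat) (p : {mpoly C[s]}) :=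
  forall S : set {mpoly C[s]}, S 0 -> (forall x y, S x -> S y -> S (x + y)) ->
    (forall a x, S x -> S (a *: x)) ->
    (forall (e : 'I_r -> nat) (m : 'X_{1..s}), (forall j, e j <= d)%N ->
       (forall i, m i < D)%N -> S ('X_[m] * \prod_j Q j ^+ e j)) ->
  S p.

Lemma spanned_le d d' D p : (d <= d')%N -> spanned d D p -> spanned d' D p.
Proof.
move=> dd' sp S S0 SD SZ SX; apply: sp => // e m ed mD.
by apply: SX => // j; apply: leq_trans (ed j) dd'.
Qed.

Lemma spannedM d D p j : spanned d D p -> spanned d.+1 D (p * Q j).
Proof.
move=> sp S S0 SD SZ SX; apply: (sp (fun p => S (p * Q j))).
- by rewrite mul0r.
- by move=> x y Sx Sy; rewrite mulrDl; apply: SD.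
- by move=> a x Sx; rewrite -scalerAl; apply: SZ.
move=> e m ed mD.
have -> : 'X_[m] * (\prod_k Q k ^+ e k) * Q j =
    'X_[m] * \prod_k Q k ^+ (e k + (k == j)).
  rewrite -mulrA; congr (_ * _); rewrite (bigD1 j) //= [RHS](bigD1 j) //= eqxx.
  rewrite addn1 exprSr mulrAC; congr (_ * _); apply: eq_bigr => k /negPf ->.
  by rewrite addn0.
by apply: SX => // k; have := ed k; case: (k == j) => /=; lia.
Qed.

(** When the ideal of the [Q j] contains a power of every variable, a monomial of
large degree [d] is a combination of the [Q j] with coefficients of degree
[d - 2], so everything reduces to monomials of bounded degree. *)
Lemma spanned_homog N d p : (forall i : 'I_s, comb Q ('X_i ^+ N)) ->
  p \is d.-homog -> spanned d (s * N + 2) p.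
Proof.
move=> XN; elim/ltn_ind: d p => d IH p ph.
have spX m : mdeg m = d -> spanned d (s * N + 2) 'X_[m].
  move=> md; have [dD|Dd] := ltnP d (s * N + 2).
    move=> S S0 SD SZ SX.
    rewrite (_ : 'X_[m] = 'X_[m] * \prod_j Q j ^+ 0); last first.
      by rewrite big1 ?mulr1.
    apply: SX => // i; apply: leq_ltn_trans dD; rewrite -md mdegE.
    by rewrite (bigD1 i) //= leq_addr.
  have [i Ni] : exists i, (N <= m i)%N.
    apply: contrapT => no; suff : (d <= s * N)%N by lia.
    rewrite -md mdegE -[s in (s * N)%N]card_ord -sum_nat_const.
    apply: leq_sum => i _; rewrite leqNgt; apply/negP => Ni.
    by apply: no; exists i; apply: ltnW.
  have [g Eg] : comb Q 'X_[m].
    have -> : 'X_[m] = 'X_[m - U_(i) *+ N] * 'X_i ^+ N :> {mpoly C[s]}.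
      rewrite mpolyXn -mpolyXD submK //; apply/mnm_lepP => k.
      rewrite mulmnE mnm1E; case: eqP => [<-|_]; by rewrite ?mul1n ?mul0n.
    exact: (idealM (comb_ideal Q)).
  case: d IH Dd md {ph} => [|[|d]] IH Dd md; try by move: Dd; lia.
  have -> : 'X_[m] = \sum_j pihomog mdeg d (g j) * Q j.
    have hX : 'X_[C, m] \is d.+2.-homog by rewrite dhomogX; apply/eqP.
    rewrite -(pihomog_dE hX) Eg linear_sum.
    by apply: eq_bigr => j _; apply: pihomogM.
  move=> S S0 SD SZ SX; apply: (big_ind S) => // j _.
  apply: (@spanned_le d.+1 d.+2 _ _ (leqnSn _) (spannedM j _)) => //.
    by apply: IH; [apply: ltnW|apply: pihomogP].
  exact: SX.
move=> S S0 SD SZ SX; rewrite [p]mpolyE big_seq; apply: (big_ind S) => // m mp.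
have md : mdeg m = d := dhomog_mf ph mp.
exact: (SZ _ _ (spX m md S S0 SD SZ SX)).
Qed.

(** If zero were the only common zero, some power of every variable would lie in the
ideal of the forms, and [spanned_homog] would bound the number of monomials with
exponents at most [k], of order [k ^ s], by a multiple of [k ^ r]. *)
Lemma Lang_Nagata : (r < s)%N ->
  exists v : 'I_s -> C, (exists i, v i != 0) /\ forall j, (Q j).@[v] = 0.
Proof.
move=> ltrs; apply: contrapT => no.
have XN i : exists N, comb Q ('X_i ^+ N).
  apply: contrapT => nX; apply: no.
  have [|v [vi Qv]] := @Nullstellensatz_coordinate C s r Q i.
    by move=> N XN; apply: nX; exists N.
  by exists v; split=> //; exists i.
have {XN} [N XN] : exists N, forall i, comb Q ('X_i ^+ N).
  have [f fP] := fin_all_exists XN.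
  exists (\max_i f i) => i; rewrite -(subnK (leq_bigmax i)) exprD.
  exact: (idealM (comb_ideal Q)).
set D := (s * N + 2)%N.
(* large enough for (s k + 1) ^ r D ^ s < (k + 1) ^ s *)
pose k := (s ^ r * D ^ s)%N; pose K := (s * k)%N.
pose I : finType := {ffun 'I_s -> 'I_k.+1}.
pose J : finType := ({ffun 'I_r -> 'I_K.+1} * {ffun 'I_s -> 'I_D})%type.
pose mon (f : I) : 'X_{1..s} := [multinom (f i : nat) | i < s].
pose b (e : J) : {mpoly C[s]} :=
  'X_[ [multinom (e.2 i : nat) | i < s] ] * \prod_j Q j ^+ e.1 j.
have monP f : exists l : J -> C, 'X_[mon f] = \sum_e l e *: b e.
  have : spanned K D 'X_[mon f].
    apply: (@spanned_le (mdeg (mon f))); last first.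
      by apply: spanned_homog => //; rewrite dhomogX.
    rewrite mdegE /K -[s in (s * k)%N]card_ord -sum_nat_const.
    by apply: leq_sum => i _; rewrite mnmE -ltnS.
  move=> /(_ (fun p => exists l : J -> C, p = \sum_e l e *: b e)); apply.
  - by exists (fun=> 0); rewrite big1 // => e _; rewrite scale0r.
  - move=> _ _ [l ->] [l' ->]; exists (fun e => l e + l' e).
    by rewrite -big_split; apply: eq_bigr => e _; rewrite scalerDl.
  - move=> a _ [l ->]; exists (fun e => a * l e).
    by rewrite scaler_sumr; apply: eq_bigr => e _; rewrite scalerA.
  move=> e m eK mD.
  pose e0 : J := ([ffun j => Ordinal (eK j : (e j < K.+1)%N)], [ffun i => Ordinal (mD i)]).
  exists (fun e' => (e' == e0)%:R); rewrite (bigD1 e0) // eqxx scale1r.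
  rewrite -[RHS]/(b e0 + _) [X in _ + X]big1 ?addr0 => [|e' ne]; last first.
    by rewrite (negPf ne) scale0r.
  rewrite /b /=.
  congr (_ * _); first by congr 'X_[_]; apply/mnmP => i; rewrite mnmE ffunE.
  by apply: eq_bigr => j _; rewrite ffunE.
have [M MP] := fin_all_exists monP.
have [|l [[f lf] lM]] := @linear_dependence C I J M.
  rewrite card_prod !card_ffun !card_ord.
  apply: (@leq_ltn_trans (k.+1 ^ r * k)%N).
    rewrite -[(k.+1 ^ r * k)%N]/(k.+1 ^ r * (s ^ r * D ^ s))%N mulnA -expnMn.
    rewrite leq_mul2r; apply/orP; right; case: (r) => // r'.
    rewrite leq_exp2r // /K mulSn [(s * k)%N]mulnC -add1n leq_add2r.
    exact: leq_ltn_trans ltrs.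
  apply: (@leq_trans (k.+1 ^ r.+1)%N); last exact: leq_pexp2l.
  by rewrite expnSr ltn_pmul2l // expn_gt0.
case/eqP: lf.
have : \sum_f l f *: 'X_[mon f] = 0 :> {mpoly C[s]}.
  under eq_bigr do rewrite MP scaler_sumr.
  rewrite exchange_big big1 //= => e _.
  under eq_bigr do rewrite scalerA.
  by rewrite -scaler_suml lM scale0r.
move/(congr1 (mcoeff (mon f))); rewrite mcoeff0 linear_sum (bigD1 f) //=.
rewrite mcoeffZ mcoeffX eqxx mulr1 big1 ?addr0 // => g gf.
rewrite mcoeffZ mcoeffX; case: eqP => [|_]; last by rewrite mulr0.
move/mnmP => E; case/eqP: gf; apply/ffunP => i; apply/val_inj.
by have := E i; rewrite !mnmE.
Qed.

End LangNagata.

(** The real and imaginary parts [u] and [v] of a common zero over the algebraic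
closure satisfy [b(u, u) = b(v, v)] and [b(u, v) = 0] for each symmetric form. *)
Lemma symmetric_systems (R : rcfType) (s r : nat) (b : 'I_r -> 'I_s -> 'I_s -> R) :
    (r < s)%N -> (forall j i k, b j i k = b j k i) ->
  exists u v : 'I_s -> R, (exists i, u i != 0 \/ v i != 0) /\
    forall j, \sum_i \sum_k b j i k * (u i * u k) =
              \sum_i \sum_k b j i k * (v i * v k) /\
              \sum_i \sum_k b j i k * (u i * v k) = 0.
Proof.
move=> ltrs bsym.
pose Q j : {mpoly R[i][s]} := \sum_i \sum_k (b j i k)%:C%C *: ('X_i * 'X_k).
have Qhomog j : Q j \is 2.-homog.
  apply: rpred_sum => i _; apply: rpred_sum => k _; apply: dhomogZ.
  by apply: (@dhomogM _ _ _ 1 _ 1); rewrite dhomogX; apply/eqP/mdeg1.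
have [w [[i0 wi0] Qw]] := Lang_Nagata Qhomog ltrs.
exists (fun i => complex.Re (w i)), (fun i => complex.Im (w i)); split.
  exists i0; have [r0|] := eqVneq (complex.Re (w i0)) 0; last by left.
  right; apply: contra_neq wi0 => m0.
  by case: (w i0) r0 m0 => x y /= -> ->.
move=> j.
have ReD : {morph @complex.Re R : x y / x + y} by move=> [? ?] [? ?].
have ImD : {morph @complex.Im R : x y / x + y} by move=> [? ?] [? ?].
have Qwj : \sum_i \sum_k (b j i k)%:C%C * (w i * w k) = 0.
  rewrite -[RHS](Qw j) rmorph_sum; apply: eq_bigr => i _.
  rewrite rmorph_sum; apply: eq_bigr => k _.
  by rewrite /= mevalZ mevalM !mevalXU.
have := congr1 (@complex.Re R) Qwj; have := congr1 (@complex.Im R) Qwj.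
rewrite (big_morph _ ImD (erefl _)) (big_morph _ ReD (erefl _)) /=.
under eq_bigr do rewrite (big_morph _ ImD (erefl _)).
under [in X in _ -> X -> _]eq_bigr do rewrite (big_morph _ ReD (erefl _)).
move=> Im0 Re0; split.
  apply/eqP; rewrite -subr_eq0 -[X in _ == X]Re0 -sumrB; apply/eqP.
  apply: eq_bigr => i _; rewrite -sumrB; apply: eq_bigr => k _.
  by case: (w i) (w k) => [? ?] [? ?] /=; ring.
set S := LHS.
have S2 : S + S = 0.
  rewrite -[RHS]Im0 /S {2}exchange_big -big_split; apply: eq_bigr => i _.
  rewrite -big_split; apply: eq_bigr => k _ /=; rewrite (bsym j k i).
  by case: (w i) (w k) => [? ?] [? ?] /=; ring.
by apply/eqP; move/eqP: S2; rewrite -mulr2n Num.Theory.mulrn_eq0.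
Qed.

Lemma symmetric_systems_fin (R : rcfType) (I J : finType) (b : J -> I -> I -> R) :
    (#|J| < #|I|)%N -> (forall j i k, b j i k = b j k i) ->
  exists u v : I -> R, (exists i, u i != 0 \/ v i != 0) /\
    forall j, \sum_i \sum_k b j i k * (u i * u k) =
              \sum_i \sum_k b j i k * (v i * v k) /\
              \sum_i \sum_k b j i k * (u i * v k) = 0.
Proof.
move=> ltJI bsym.
pose b' (j : 'I_#|J|) (i k : 'I_#|I|) := b (enum_val j) (enum_val i) (enum_val k).
have [|u [v [[i0 uv0] uvP]]] := symmetric_systems (b := b') ltJI.
  by move=> j i k; apply: bsym.
have sumE j (x y : 'I_#|I| -> R) :
    \sum_i \sum_k b' (enum_rank j) i k * (x i * y k) =
    \sum_i \sum_k b j i k * (x (enum_rank i) * y (enum_rank k)).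
  rewrite (reindex (@enum_rank I)) /=; last exact/onW_bij/enum_rank_bij.
  apply: eq_bigr => i _.
  rewrite (reindex (@enum_rank I)) /=; last exact/onW_bij/enum_rank_bij.
  by apply: eq_bigr => k _; rewrite /b' !enum_rankK.
exists (u \o enum_rank), (v \o enum_rank); split.
  by exists (enum_val i0); rewrite /= enum_valK.
by move=> j; have := uvP (enum_rank j); rewrite !sumE.
Qed.

(** * Ternary quadratic forms over function fields of curves *)

Section Span.
Variables (D B : comNzRingType) (g : {rmorphism D -> B}).

(** A quantification over submodules: closure properties of spans then need no
bookkeeping of coefficients, which are recovered by [span_of_sum]. *)
Definition span_of (E : seq B) (x : B) :=
  forall S : set B, S 0 -> (forall x y, S x -> S y -> S (x + y)) ->
    (forall a x, S x -> S (g a * x)) -> (forall e, e \in E -> S e) -> S x.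

Lemma span_of0 E : span_of E 0. Proof. by move=> S. Qed.

Lemma span_ofD E x y : span_of E x -> span_of E y -> span_of E (x + y).
Proof. by move=> sx sy S S0 SD SZ SE; apply: (SD); [apply: sx|apply: sy]. Qed.

Lemma span_ofZ E a x : span_of E x -> span_of E (g a * x).
Proof. by move=> sx S S0 SD SZ SE; apply: (SZ); apply: sx. Qed.

Lemma span_of_mem E e : e \in E -> span_of E e.
Proof. by move=> eE S S0 SD SZ; apply. Qed.

Lemma span_of_subset E E' (h : B) x : (forall e, e \in E -> span_of E' (e * h)) ->
  span_of E x -> span_of E' (x * h).
Proof.
move=> EE' /(_ (fun x => span_of E' (x * h))); apply.
- by rewrite mul0r; apply: span_of0.
- by move=> y z sy sz; rewrite mulrDl; apply: span_ofD.
- by move=> a y sy; rewrite -mulrA; apply: span_ofZ.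
- exact: EE'.
Qed.

Lemma span_of_sum E x : span_of E x ->
  exists l : nat -> D, x = \sum_(i < size E) g (l i) * E`_i.
Proof.
move=> /(_ (fun x => exists l : nat -> D, x = \sum_(i < size E) g (l i) * E`_i)).
apply.
- by exists (fun=> 0); rewrite big1 // => i _; rewrite rmorph0 mul0r.
- move=> _ _ [l ->] [l' ->]; exists (fun i => l i + l' i).
  by rewrite -big_split; apply: eq_bigr => i _; rewrite rmorphD mulrDl.
- move=> a _ [l ->]; exists (fun i => a * l i).
  by rewrite mulr_sumr; apply: eq_bigr => i _; rewrite rmorphM mulrA.
move=> e eE; exists (fun i => (i == index e E)%:R).
rewrite (bigD1 (Ordinal (_ : index e E < size E)%N)) ?index_mem //= => ieE.
rewrite eqxx rmorph1 mul1r nth_index // big1 ?addr0 // => i ie.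
case: eqP => [ie'|_]; last by rewrite rmorph0 mul0r.
by case/eqP: ie; apply/val_inj.
Qed.

Lemma sum_span_of E (l : nat -> D) : span_of E (\sum_(i < size E) g (l i) * E`_i).
Proof.
move=> S S0 SD SZ SE; apply: (big_ind S) => // i _.
by apply: SZ; apply: SE; apply: mem_nth.
Qed.

End Span.

(** The products of powers of the generators, each below the degree of an equation
of that generator, span up to the leading coefficients of these equations. *)
Lemma spanning_up_to_denominators (D : comNzRingType) (B : idomainType)
    (g : {rmorphism D -> B}) (ys : seq B) :
    generates g ys -> (forall y, algebraic_over g y) ->
  exists E, 1 \in E /\ forall x, exists d, g d != 0 /\ span_of g E (g d * x).
Proof.
move=> gen alg.
have [E [E1 EP]] : exists E, 1 \in E /\ forall y e, y \in ys -> e \in E ->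
    exists d, g d != 0 /\ span_of g E (g d * (e * y)).
  elim: ys {gen} => [|y ys [E [E1 IH]]]; first by exists [:: 1]; rewrite mem_head.
  have [p [p0 py]] := alg y.
  pose k := (size (map_poly g p)).-1.
  have szp : size (map_poly g p) = k.+1 by rewrite prednK // size_poly_gt0.
  have gk : g p`_k != 0.
    by rewrite -coef_map -/(lead_coef _) lead_coef_eq0.
  have yk : g p`_k * y ^+ k = - \sum_(i < k) g p`_i * y ^+ i.
    move: py; rewrite evE horner_coef szp big_ord_recr /= coef_map.
    under eq_bigr do rewrite coef_map.
    by move/eqP; rewrite addrC addr_eq0 => /eqP.
  have k0 : (0 < k)%N.
    rewrite lt0n; apply: contraNneq gk => k0.
    by move: yk; rewrite k0 big_ord0 oppr0 expr0 mulr1 => ->.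
  exists [seq e * y ^+ i | e <- E, i <- iota 0 k]; split.
    by rewrite -[1]mulr1 -[X in _ * X](expr0 y); apply: allpairs_f => //; rewrite mem_iota.
  move=> z _ + /allpairsP [[e i] /= [eE ik ->]].
  rewrite mem_iota add0n /= in ik.
  rewrite inE => /predU1P [->|zys]; last first.
    have [d [d0 sp]] := IH z e zys eE; exists d; split=> //.
    rewrite mulrAC mulrA; apply: span_of_subset sp => e' e'E.
    by apply: span_of_mem; apply: allpairs_f => //; rewrite mem_iota.
  rewrite -mulrA -exprSr; move: ik; rewrite leq_eqVlt => /predU1P [->|ik].
    exists p`_k; split=> //; rewrite mulrCA yk mulrN mulr_sumr -sumrN.
    move=> S S0 SD SZ SE; apply: (big_ind S) => // j _.
    rewrite mulrCA -mulNr -[- g _]rmorphN; apply: SZ; apply: SE.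
    by apply: allpairs_f => //; rewrite mem_iota add0n /=.
  exists 1; rewrite rmorph1 oner_neq0 mul1r; split=> //.
  by apply: span_of_mem; apply: allpairs_f => //; rewrite mem_iota.
exists E; split=> //.
suff H x : forall e, e \in E -> exists d, g d != 0 /\ span_of g E (g d * (e * x)).
  by move=> x; have := H x 1 E1; rewrite mul1r.
have dE z y : (forall e, e \in E -> exists d, g d != 0 /\ span_of g E (g d * (e * y))) ->
    span_of g E z -> exists d, g d != 0 /\ span_of g E (g d * (z * y)).
  move=> yE.
  move=> /(_ (fun z => exists d, g d != 0 /\ span_of g E (g d * (z * y)))); apply.
  - by exists 1; rewrite rmorph1 oner_neq0 mul0r mulr0; split=> //; apply: span_of0.
  - move=> a b [d [d0 sd]] [e [e0 se]]; exists (d * e); rewrite rmorphM mulf_neq0 //.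
    split=> //; rewrite mulrDl mulrDr; apply: span_ofD.
      by rewrite [g d * _]mulrC -mulrA; apply: span_ofZ.
    by rewrite -mulrA; apply: span_ofZ.
  - move=> a b [d [d0 sd]]; exists d; split=> //.
    by rewrite -mulrA mulrCA; apply: span_ofZ.
  - exact: yE.
apply: (gen (fun x => forall e, e \in E -> exists d, g d != 0 /\
  span_of g E (g d * (e * x)))) => [a b Ha Hb e eE|a b Ha Hb e eE|a e eE|y yys e eE].
- have [d [d0 sd]] := Ha e eE; have [d' [d'0 sd']] := Hb e eE.
  exists (d * d'); rewrite rmorphM mulf_neq0 //; split=> //.
  rewrite !mulrDr; apply: span_ofD.
    by rewrite [g d * _]mulrC -mulrA; apply: span_ofZ.
  by rewrite -mulrA; apply: span_ofZ.
- have [d [d0 sd]] := Ha e eE; have [d' [d'0 sd']] := dE _ b Hb sd.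
  by exists (d' * d); rewrite rmorphM mulf_neq0 //; split=> //; rewrite -mulrA [e * _]mulrA [g d * _]mulrA.
- exists 1; rewrite rmorph1 oner_neq0 mul1r mulrC; split=> //.
  by apply: span_ofZ; apply: span_of_mem.
- exact: EP.
Qed.

Lemma free_spanning_subfamily (F : fieldType) (B : comNzRingType)
    (c : {rmorphism F -> B}) (L : seq B) :
  exists L' : seq B, [/\ (size L' <= size L)%N, {subset L' <= L},
    forall x, x \in L -> span_of c L' x &
    forall l : nat -> F, \sum_(i < size L') c (l i) * L'`_i = 0 ->
      forall i, (i < size L')%N -> l i = 0].
Proof.
elim: L => [|x L [L' [szL' subL' spL' freeL']]]; first by exists [::].
have [spx|nspx] := pselect (span_of c L' x).
  exists L'; split=> //; first exact: leqW.
    by move=> y /subL' yL; rewrite inE yL orbT.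
  by move=> y; rewrite inE => /predU1P [->|/spL'].
exists (x :: L'); split=> //.
- by move=> y; rewrite !inE => /predU1P [->|/subL' ->]; rewrite ?eqxx ?orbT.
- move=> y; rewrite inE => /predU1P [->|/spL' sy].
    by apply: span_of_mem; rewrite mem_head.
  rewrite -[y]mulr1; apply: span_of_subset sy => e eL'; rewrite mulr1.
  by apply: span_of_mem; rewrite inE eL' orbT.
move=> l /=; rewrite big_ord_recl /= => E.
have [l0|l0] := eqVneq (l 0) 0; last first.
  case: nspx; have -> : x = c (- (l 0)^-1) * \sum_(i < size L') c (l i.+1) * L'`_i.
    move/eqP: E; rewrite addrC addr_eq0 => /eqP ->.
    by rewrite rmorphN mulrNN mulrA -rmorphM mulVf // rmorph1 mul1r.
    exact: (@span_ofZ _ _ c _ _ _ (@sum_span_of _ _ c L' (fun i => l i.+1))).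
move: E; rewrite l0 rmorph0 mul0r add0r => /(freeL' (fun i => l i.+1)) lS.
by case=> // i; apply: lS.
Qed.

(** Otherwise [h] would be multiplied by three each time its argument is roughly
doubled, which is too much for a function of linear growth. *)
Lemma growth (h : nat -> nat) (M k : nat) :
    (forall N, 0 < h N)%N -> (forall N, h N <= N.+1 * M)%N ->
  exists N, (h (2 * N + k) < 3 * h N)%N.
Proof.
move=> h0 hM; apply: contrapT => no.
have h3 N : (3 * h N <= h (2 * N + k))%N.
  by rewrite leqNgt; apply/negP => hN; apply: no; exists N.
have H n : exists2 N, (N + k = 2 ^ n * k)%N & (3 ^ n <= h N)%N.
  elim: n => [|n [N NE hN]]; first by exists 0%N; rewrite ?mul1n.
  exists (2 * N + k)%N; first by rewrite expnS -mulnA -NE; lia.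
  by apply: leq_trans (h3 N); rewrite expnS leq_mul2l.
have B n : (3 ^ n <= 2 ^ n * (k.+1 * M))%N.
  have [N NE hN] := H n; apply: leq_trans hN _; apply: leq_trans (hM N) _.
  rewrite mulnA leq_mul2r; apply/orP; right.
  have : (0 < 2 ^ n)%N by rewrite expn_gt0.
  by rewrite mulnS -NE; lia.
pose m := (k.+1 * M)%N.
have B2 n : (n.+1 * 2 ^ n <= 2 * 3 ^ n)%N.
  elim: n => // n IH; rewrite !expnS.
  case: n IH => // n IH.
  have := IH; rewrite !expnS; have : (0 < 2 ^ n)%N by rewrite expn_gt0.
  by nia.
have := B2 (2 * m)%N; have := B (2 * m)%N; rewrite -/m.
have : (0 < 2 ^ (2 * m))%N by rewrite expn_gt0.
by nia.
Qed.

Section Tsen.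
Variables (R : rcfType) (B : idomainType) (c : {rmorphism R -> B}) (t : B).
Local Notation g := (ev c t).

(** These products span a piece of [B] whose dimension over [R] grows linearly with
[N]. *)
Definition filtration (E : seq B) (N : nat) : seq B :=
  [seq e * t ^+ a | e <- E, a <- iota 0 N.+1].
Local Notation W E N := (span_of c (filtration E N)).

Lemma filtration_mem E N e a : e \in E -> (a <= N)%N -> e * t ^+ a \in filtration E N.
Proof. by move=> eE aN; apply: allpairs_f => //; rewrite mem_iota. Qed.

Lemma filtrationP E N x : x \in filtration E N ->
  exists e a, [/\ e \in E, (a <= N)%N & x = e * t ^+ a].
Proof.
move=> /allpairsP [[e a] [eE aN ->]]; exists e, a; split=> //.
by move: aN; rewrite mem_iota add0n ltnS.
Qed.

Lemma filtration_shift E N a x : W E N x -> W E (N + a) (x * t ^+ a).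
Proof.
apply: span_of_subset => _ /filtrationP [e [b [eE bN ->]]].
rewrite -mulrA -exprD; apply: span_of_mem; apply: filtration_mem => //.
by rewrite leq_add2r.
Qed.

Lemma filtration_le E N N' x : (N <= N')%N -> W E N x -> W E N' x.
Proof.
move=> NN'; rewrite -[x in X in _ -> X]mulr1; apply: span_of_subset.
move=> _ /filtrationP [e [b [eE bN ->]]].
rewrite mulr1; apply: span_of_mem; apply: filtration_mem => //.
exact: leq_trans NN'.
Qed.

Lemma filtrationZ E N (p : {poly R}) x : W E N x -> W E (N + size p) (g p * x).
Proof.
move=> Wx; rewrite evE (horner_coef_wide _ (size_poly _ _)) mulr_suml.
apply: (big_ind (W E _)) => [|y z|i _]; first exact: span_of0.
  exact: span_ofD.
rewrite coef_map -mulrA; apply: (@span_ofZ _ _ c); rewrite mulrC.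
by apply: filtration_le (filtration_shift Wx); rewrite leq_add2l ltnW.
Qed.

Lemma filtration_exhaustive E x : span_of g E x -> exists N, W E N x.
Proof.
move=> /(_ (fun x => exists N, W E N x)); apply.
- by exists 0%N; apply: span_of0.
- move=> y z [N Wy] [N' Wz]; exists (maxn N N'); apply: span_ofD.
    by apply: filtration_le Wy; apply: leq_maxl.
  by apply: filtration_le Wz; apply: leq_maxr.
- by move=> p y [N Wy]; exists (N + size p)%N; apply: filtrationZ.
- move=> e eE; exists 0%N; rewrite -[e]mulr1 -(expr0 t).
  by apply: span_of_mem; apply: filtration_mem.
Qed.

Lemma filtration_common_denominator E (L : seq B) :
    (forall x, exists d, g d != 0 /\ span_of g E (g d * x)) ->
  exists d N, g d != 0 /\ forall x, x \in L -> W E N (g d * x).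
Proof.
move=> EP; elim: L => [|x L [d [N [d0 WL]]]].
  by exists 1, 0%N; rewrite rmorph1 oner_neq0.
have [d' [d'0 /filtration_exhaustive [N' Wx]]] := EP x.
exists (d * d'), (maxn (N + size d') (N' + size d)).
rewrite rmorphM mulf_neq0 //; split=> // y; rewrite inE => /predU1P [->|/WL Wy].
  by rewrite -mulrA; apply: filtration_le (filtrationZ Wx); apply: leq_maxr.
rewrite [g d * _]mulrC -mulrA.
by apply: filtration_le (filtrationZ Wy); apply: leq_maxl.
Qed.

(** Multiplication is bilinear, so a common denominator [d] of the finitely many
products of elements of [E] controls all products. *)
Lemma filtration_mul E N N' k d f x y :
    (forall e e', e \in E -> e' \in E -> W E k (d * (f * (e * e')))) ->
  W E N x -> W E N' y -> W E (N + N' + k) (d * (f * (x * y))).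
Proof.
move=> fE Wx Wy.
have Ex : forall e, e \in filtration E N ->
    W E (N + N' + k) (e * (d * (f * y))).
  move=> _ /filtrationP [e [a [eE aN ->]]].
  rewrite (_ : _ * _ = y * (d * (f * (e * t ^+ a)))); last by ring.
  apply: span_of_subset Wy.
  move=> _ /filtrationP [e' [b [e'E bN ->]]].
  have -> : e' * t ^+ b * (d * (f * (e * t ^+ a))) =
      d * (f * (e * e')) * t ^+ (a + b) by rewrite exprD; ring.
  apply: filtration_le (filtration_shift (fE e e' eE e'E)).
  by rewrite addnC leq_add2r leq_add.
have -> : d * (f * (x * y)) = x * (d * (f * y)) by ring.
exact: (span_of_subset Ex Wx).
Qed.

(** This is Tsen's theorem for the conic [f] over the function field extended by a
square root of minus one, written in real and imaginary parts.  For [x] in the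
[N]-th piece of the filtration the value [f(x, x)], up to a fixed denominator, lies
in the piece of index [2 N + k]; the three coordinates of [x] provide [3 h(N)]
unknowns for [h(2 N + k)] quadratic equations, and by [growth] there are more
unknowns than equations for some [N]. *)
Lemma Tsen (ys : seq B) (f : 'I_3 -> B) :
    generates c ys -> (forall y, algebraic_over g y) ->
  exists u v : 'I_3 -> B, [/\ exists l, u l != 0 \/ v l != 0,
    \sum_l f l * (u l * u l) = \sum_l f l * (v l * v l) &
    \sum_l f l * (u l * v l) = 0].
Proof.
move=> gen alg.
have [E [E1 EP]] := spanning_up_to_denominators (@generates_ev _ _ c t ys gen) alg.
have [d [k [d0 dP]]] :=
  filtration_common_denominator 
    [seq x * e' | x <- [seq f l * e | l <- enum 'I_3, e <- E], e' <- E] EP.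
have dfE l e e' : e \in E -> e' \in E -> W E k (g d * (f l * (e * e'))).
  move=> eE e'E; rewrite [f l * _]mulrA; apply: dP.
  by do 2!apply: allpairs_f => //; rewrite mem_enum.
have basis N : exists L : seq B, [/\ (0 < size L)%N, (size L <= N.+1 * size E)%N,
    forall x, x \in L -> W E N x,
    forall x, W E N x -> span_of c L x &
    forall l : nat -> R, \sum_(i < size L) c (l i) * L`_i = 0 ->
      forall i, (i < size L)%N -> l i = 0].
  have [L [szL subL spL freeL]] := free_spanning_subfamily c (filtration E N).
  exists L; split=> //.
  - rewrite lt0n; apply/eqP => /size0nil L0.
    have [|l] := @span_of_sum _ _ c L (1 * t ^+ 0).
      by apply: spL; apply: filtration_mem.
    by rewrite L0 big_ord0 mulr1 => /eqP; rewrite oner_eq0.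
  - by rewrite mulnC; move: szL; rewrite size_allpairs size_iota.
  - by move=> x /subL; apply: span_of_mem.
  - move=> x Wx; rewrite -[x]mulr1; apply: span_of_subset Wx => e /spL.
    by rewrite mulr1.
have [L LP] := choice basis.
have [N ltN] : exists N, (size (L (2 * N + k)) < 3 * size (L N))%N.
  apply: (@growth (fun N => size (L N)) (size E)) => N; first by case: (LP N).
  by case: (LP N).
set L1 := L N in ltN; set L2 := L (2 * N + k)%N in ltN.
have [_ _ L1W _ freeL1] := LP N; have [_ _ _ W2 _] := LP (2 * N + k)%N.
have crd x : exists l : nat -> R, W E (2 * N + k) x ->
    x = \sum_(j < size L2) c (l j) * L2`_j.
  have [Wx|nWx] := pselect (W E (2 * N + k) x); last by exists (fun=> 0).
  by have [l xl] := span_of_sum (W2 x Wx); exists l.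
have {crd} [crd crdP] := choice crd.
pose I : finType := ('I_3 * 'I_(size L1))%type.
pose b (j : 'I_(size L2)) (p q : I) : R :=
  if p.1 == q.1 then crd (g d * (f p.1 * (L1`_p.2 * L1`_q.2))) j else 0.
have [||u [v [[[l0 i0] uv0] uvP]]] := @symmetric_systems_fin R I _ b.
- by rewrite card_prod !card_ord.
- move=> j p q; rewrite /b eq_sym; case: eqP => // ->.
  by rewrite [L1`_p.2 * _]mulrC.
pose V (w : I -> R) l := \sum_(i < size L1) c (w (l, i)) * L1`_i.
have VE (w z : I -> R) : g d * (\sum_l f l * (V w l * V z l)) =
    \sum_(j < size L2) c (\sum_p \sum_q b j p q * (w p * z q)) * L2`_j.
  pose be l i k' := crd (g d * (f l * (L1`_i * L1`_k'))).
  transitivity (\sum_(l < 3) \sum_(i < size L1) \sum_(k' < size L1)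
      \sum_(j < size L2) c (be l i k' j * (w (l, i) * z (l, k'))) * L2`_j).
    rewrite mulr_sumr; apply: eq_bigr => l _.
    rewrite /V mulr_suml !mulr_sumr; apply: eq_bigr => i _.
    rewrite !mulr_sumr; apply: eq_bigr => k' _.
    have Wb : W E (2 * N + k) (g d * (f l * (L1`_i * L1`_k'))).
      rewrite mul2n -addnn; apply: filtration_mul; first exact: dfE.
        by apply: L1W; apply: mem_nth.
      by apply: L1W; apply: mem_nth.
    transitivity (c (w (l, i)) * c (z (l, k')) * (g d * (f l * (L1`_i * L1`_k')))).
      by ring.
    rewrite (crdP _ Wb) mulr_sumr; apply: eq_bigr => j _.
    by rewrite !rmorphM /be; ring.
  transitivity (\sum_(l < 3) \sum_(i < size L1) \sum_(j < size L2)
      \sum_(k' < size L1) c (be l i k' j * (w (l, i) * z (l, k'))) * L2`_j).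
    by apply: eq_bigr => l _; apply: eq_bigr => i _; rewrite exchange_big.
  transitivity (\sum_(l < 3) \sum_(j < size L2) \sum_(i < size L1)
      \sum_(k' < size L1) c (be l i k' j * (w (l, i) * z (l, k'))) * L2`_j).
    by apply: eq_bigr => l _; rewrite exchange_big.
  rewrite exchange_big; apply: eq_bigr => j _ /=.
  have pairE (F : I -> R) : \sum_p F p = \sum_l \sum_i F (l, i).
    by rewrite pair_bigA; apply: eq_bigr => -[].
  rewrite pairE.
  rewrite rmorph_sum mulr_suml; apply: eq_bigr => l _.
  rewrite rmorph_sum mulr_suml; apply: eq_bigr => i _.
  rewrite pairE (bigD1 l) //= [X in _ + X]big1 => [|l' ll']; last first.
    by apply: big1 => k' _; rewrite /b /= eq_sym (negPf ll') mul0r.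
  rewrite addr0 rmorph_sum mulr_suml; apply: eq_bigr => k' _.
  by rewrite /b /= eqxx.
exists (V u), (V v); split.
- exists l0; case: uv0 => w0; [left|right]; apply: contraNneq w0 => V0; apply/eqP.
    pose l i := if insub i is Some i' then u (l0, i') else 0.
    have -> : u (l0, i0) = l i0 by rewrite /l valK.
    apply: freeL1 => //; rewrite -[RHS]V0; apply: eq_bigr => i _.
    by rewrite /l valK.
  pose l i := if insub i is Some i' then v (l0, i') else 0.
  have -> : v (l0, i0) = l i0 by rewrite /l valK.
  apply: freeL1 => //; rewrite -[RHS]V0; apply: eq_bigr => i _.
  by rewrite /l valK.
- apply: (mulfI d0); rewrite !VE; apply: eq_bigr => j _.
  by have [-> _] := uvP j.
- apply: (mulfI d0); rewrite VE mulr0 big1 // => j _.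
  by have [_ ->] := uvP j; rewrite rmorph0 mul0r.
Qed.

End Tsen.

(** * Orderings *)

Section Topology.
Variable B : comNzRingType.

Lemma open_basic_open (fs : seq B) : open (basic_open fs).
Proof.
exists [set basic_open fs]; last by rewrite bigcup_set1.
move=> _ ->; exists [fset fs]%fset; first by move=> x _; rewrite in_setT.
apply/seteqP; split=> [alpha H|alpha H fs'].
  by apply: H; rewrite /= inE.
by rewrite /= inE => /eqP ->.
Qed.

Lemma nbhs_basic_open (alpha : specr B) (U : set (specr B)) :
  nbhs alpha U -> exists fs, basic_open fs alpha /\ basic_open fs `<=` U.
Proof.
rewrite nbhsE => -[V [[D' sD' <-] [i D'i ialpha]] VU].
have [F _ Fi] := sD' i D'i.
exists (flatten (enum_fset F)); split.
  move=> f /flattenP [fs fsF ffs].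
  by move: ialpha; rewrite -Fi => /(_ fs fsF); apply.
apply: subset_trans VU => beta Hb; exists i => //; suff: i beta by []; rewrite -Fi => fs fsF f ffs.
by apply: Hb; apply/flattenP; exists fs.
Qed.
End Topology.

Section Orderings.
Variables (B : comNzRingType) (alpha : specr B).
Local Notation P := (cone_of alpha).

Lemma coneD a b : P a -> P b -> P (a + b).
Proof. by have [[[H _ _] _] _] := cone_ofP alpha; apply: H. Qed.

Lemma coneM a b : P a -> P b -> P (a * b).
Proof. by have [[[_ H _] _] _] := cone_ofP alpha; apply: H. Qed.

Lemma coneX a : P (a ^+ 2).
Proof. by have [[[_ _ H] _] _] := cone_ofP alpha; apply: H. Qed.

Lemma coneN1 : ~ P (- 1).
Proof. by have [[_ H] _] := cone_ofP alpha. Qed.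

Lemma cone_prime a b : P (a * b) -> P a \/ P (- b).
Proof. by have [_ H] := cone_ofP alpha; apply: H. Qed.

Lemma cone0 : P 0. Proof. by have := coneX 0; rewrite expr0n. Qed.

Lemma cone1 : P 1. Proof. by rewrite -(expr1n _ 2); apply: coneX. Qed.

Lemma cone_total a : P a \/ P (- a).
Proof. by apply: cone_prime; rewrite -expr2; apply: coneX. Qed.

Lemma pos_atP a : pos_at a alpha <-> ~ P (- a).
Proof.
split=> [[Pa na] PNa|nPNa]; first exact: na.
by split=> [|[]//]; case: (cone_total a).
Qed.

Lemma supp_ideal : is_ideal (supp alpha).
Proof.
split.
- by rewrite /supp /= oppr0; split; apply: cone0.
- by move=> x y [Px PNx] [Py PNy]; split; rewrite ?opprD; apply: coneD.
- move=> a x [Px PNx]; case: (cone_total a) => Pa; split.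
  + exact: coneM.
  + by rewrite -mulrN; apply: coneM.
  + by rewrite -mulrNN; apply: coneM.
  + by rewrite -mulNr; apply: coneM.
Qed.

Lemma supp_prime : is_prime (supp alpha).
Proof.
split; [exact: supp_ideal|by move=> [_ /coneN1]|move=> x y [Pxy PNxy]].
apply: contrapT => /not_orP [nx ny].
have one z : ~ supp alpha z -> exists b : bool, ~ P ((-1) ^+ b * z).
  move=> nz; have [Pz|nPz] := pselect (P z).
    by exists true => PNz; apply: nz; split=> //; rewrite -mulN1r.
  by exists false; rewrite mul1r.
have [b nPx] := one x nx; have [d nPy] := one y ny.
have [] // := @cone_prime ((-1) ^+ b * x) (- ((-1) ^+ d * y)); last by rewrite opprK.
have -> : (-1) ^+ b * x * - ((-1) ^+ d * y) = (-1) ^+ (b + d).+1 * (x * y).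
  by rewrite exprS exprD; ring.
by rewrite -signr_odd; case: odd; rewrite ?mulN1r ?mul1r.
Qed.

Lemma pos_at1 : pos_at 1 alpha. Proof. exact/pos_atP/coneN1. Qed.

Lemma pos_at_notin_supp a : pos_at a alpha -> ~ supp alpha a.
Proof. by case. Qed.

Lemma pos_at_sqr_mul a b : pos_at a alpha -> ~ supp alpha b ->
  pos_at (a * b ^+ 2) alpha.
Proof.
move=> [Pa na] nb; split=> [|/(primeM supp_prime) [//|]].
  by apply: coneM => //; apply: coneX.
by rewrite expr2 => /(primeM supp_prime) [].
Qed.

Lemma pos_at_congr a b : pos_at a alpha -> supp alpha (b - a) -> pos_at b alpha.
Proof.
move=> /pos_atP na [Pba _]; apply/pos_atP => PNb; apply: na.
by rewrite (_ : - a = (b - a) + - b); [apply: coneD|ring].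
Qed.

(** If [f0] is positive then [s + t * f0] is nonnegative, and the hypothesis says that
it exceeds [g] in absolute value: the factor [(1 + f0) ^+ 2] is at least [f0]. *)
Lemma pos_at_dominates (f0 f1 d s t g : B) :
    P s -> P t -> d ^+ 2 * f1 = s + t * f0 + g ->
    pos_at (f0 * (s + t * f0) ^+ 2 - ((1 + f0) * g) ^+ 2) alpha ->
  pos_at f0 alpha /\ pos_at f1 alpha.
Proof.
move=> Ps Pt E /pos_atP nf; set e := s + t * f0 in E nf.
have nf0 : ~ P (- f0).
  move=> PNf0; apply: nf; rewrite opprB addrC -mulNr.
  by apply: coneD; [apply: coneM => //|]; apply: coneX.
have Pf0 : P f0 by case: (cone_total f0).
have Pe : P e by apply: coneD => //; apply: coneM.
split; apply/pos_atP => // PNf1; apply: nf.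
have PNeg : P (- (e + g)) by rewrite -E -mulrN; apply: coneM => //; apply: coneX.
rewrite (_ : - _ = (1 + f0 + f0 ^+ 2) * g ^+ 2 +
                   f0 * (- (e + g) * (- (e + g) + (e + e)))); last by ring.
apply: coneD; apply: coneM => //; first last.
- by apply: coneM => //; apply: coneD => //; apply: coneD.
- exact: coneX.
- by apply: coneD; [apply: coneD => //; apply: cone1|apply: coneX].
Qed.

End Orderings.

Lemma sums_of_squares_cone (B : comNzRingType) (P : set B) x :
  is_cone P -> sums_of_squares x -> P x.
Proof.
move=> [PD _ PX] [s ->]; apply: (big_ind P) => //.
by have := PX 0; rewrite expr0n.
Qed.

Lemma sums_of_squares_is_cone (B : comNzRingType) : is_cone (@sums_of_squares B).
Proof.
split.
- by move=> _ _ [s ->] [s' ->]; exists (s ++ s'); rewrite big_cat.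
- move=> _ _ [s ->] [s' ->]; exists [seq x * y | x <- s, y <- s'].
  rewrite big_allpairs_dep mulr_suml; apply: eq_bigr => x _.
  by rewrite mulr_sumr; apply: eq_bigr => y _; rewrite exprMn.
- by move=> b; exists [:: b]; rewrite big_seq1.
Qed.

(** If [a] and [- a] were both outside a maximal proper cone [P], the cones [P + a P]
and [P - a P] would contain [- 1], and the product of the two relations would put
[- 1] into [P].  So [P] is total; in a field totality is enough for the primality
condition because the support is zero. *)
Lemma ordering_extending_cone (B : comNzRingType) (T : set B) :
  is_proper_cone T -> (forall x : B, x != 0 -> exists y, x * y = 1) ->
  exists Q : specr B, T `<=` cone_of Q.
Proof.
move=> [Tcone TN1] Bfield.
pose G := [set P : set B | is_proper_cone P /\ T `<=` P].
have [| | |P [[[Pcone PN1] TP] Pmax]] := @Zorn_above B G T.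
- by split.
- by exists (0 ^+ 2); case: Tcone.
- move=> F FG [X0 FX0] totF.
  have two x y : (\bigcup_(X in F) X) x -> (\bigcup_(X in F) X) y ->
      exists X, [/\ F X, X x & X y].
    move=> [X FX Xx] [Y FY Yy]; case: (totF X Y FX FY) => XY.
      by exists Y; split=> //; apply: XY.
    by exists X; split=> //; apply: XY.
  split; [split|]; [split| |].
  + move=> x y Ux Uy; have [X [FX Xx Xy]] := two x y Ux Uy; exists X => //.
    by case: (FG X FX) => -[[XD _ _] _] _; apply: XD.
  + move=> x y Ux Uy; have [X [FX Xx Xy]] := two x y Ux Uy; exists X => //.
    by case: (FG X FX) => -[[_ XM _] _] _; apply: XM.
  + by move=> b; exists X0 => //; case: (FG X0 FX0) => -[[_ _ XX] _] _; apply: XX.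
  + by move=> [X FX XN1]; case: (FG X FX) => -[_ nXN1] _; apply: nXN1.
  + by move=> x Tx; exists X0 => //; case: (FG X0 FX0) => _; apply.
have [PD PM PX] := Pcone.
have P0 : P 0 by have := PX 0; rewrite expr0n.
have P1 : P 1 by rewrite -(expr1n B 2); apply: PX.
have ext a : ~ P a -> exists x y, [/\ P x, P y & - 1 = x + a * y].
  move=> nPa; pose Pa := [set z | exists x y, [/\ P x, P y & z = x + a * y]].
  have PPa : P `<=` Pa by move=> x Px; exists x, 0; rewrite mulr0 addr0.
  apply: contrapT => nN1; apply: nPa; apply: (Pmax Pa) => //; last first.
    by exists 0, 1; rewrite mulr1 add0r.
  split; last by move=> x /TP /PPa.
  split=> //; split.
  - move=> _ _ [x [y [Px Py ->]]] [z [w [Pz Pw ->]]].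
    exists (x + z), (y + w); split; [exact: PD|exact: PD|ring].
  - move=> _ _ [x [y [Px Py ->]]] [z [w [Pz Pw ->]]].
    exists (x * z + a ^+ 2 * (y * w)), (x * w + y * z).
    split; [|by apply: (PD); apply: PM|ring].
    by apply: (PD); [apply: PM|apply: (PM); [apply: PX|apply: PM]].
  - by move=> b; exists (b ^+ 2), 0; rewrite mulr0 addr0.
have total a : P a \/ P (- a).
  apply: contrapT => /not_orP [/ext [x [y [Px Py E1]]] /ext [z [w [Pz Pw E2]]]].
  apply: PN1; rewrite (_ : - 1 = x + z + x * z + a ^+ 2 * (y * w)).
    apply: (PD); last by apply: (PM); [apply: PX|apply: PM].
    by apply: (PD); [apply: PD|apply: PM].
  have -> : a ^+ 2 * (y * w) = - ((- 1 - x) * (- 1 - z)).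
    by rewrite {1}E1 {1}E2; ring.
  ring.
have supp0 a : P a -> P (- a) -> a = 0.
  move=> Pa PNa; apply: contrapT => /eqP /Bfield [y ay]; apply: PN1.
  rewrite (_ : - 1 = a * (- a) * y ^+ 2); last by rewrite -ay; ring: ay.
  by apply: (PM); [apply: (PM)|].
have Pord : is_ordering P.
  split=> // a b Pab; apply: contrapT => /not_orP [nPa nPNb].
  have PNa : P (- a) by case: (total a).
  have Pb : P b by case: (total b).
  have ab0 : a * b = 0 by apply: supp0 => //; rewrite -mulNr; apply: PM.
  have /Bfield [y ay] : a != 0 by apply: contra_notN nPa => /eqP ->.
  apply: nPNb; suff -> : b = 0 by rewrite oppr0.
  by rewrite -[b]mul1r -ay mulrAC ab0 mul0r.
by exists (Specr Pord).
Qed.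

(** * Dimension *)

Lemma prime_preimage (A B : comNzRingType) (f : {rmorphism A -> B}) (P : set B) :
  is_prime P -> is_prime (f @^-1` P).
Proof.
move=> [[P0 PD PM] P1 PP]; split; [split|by rewrite /= rmorph1|] => /=.
- by rewrite rmorph0.
- by move=> x y Px Py; rewrite rmorphD; apply: PD.
- by move=> a x Px; rewrite rmorphM; apply: PM.
- by move=> x y; rewrite rmorphM; apply: PP.
Qed.

Lemma no_prime_chain (A : comNzRingType) (S : nat -> set A) :
    krull_dim_le A 2 -> (forall i, is_prime (S i)) ->
    (forall i, S i `<=` S i.+1) ->
    ~ (forall i, (i < 3)%N -> exists2 x, S i.+1 x & ~ S i x).
Proof.
move=> dimA Sprime Sle Slt.
have [Q QP] := choice (fun i => prime_idealr_of_set (Sprime i)).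
suff : (3 <= 2)%N by [].
have mono i j : (i <= j)%N -> S i `<=` S j.
  move=> /subnK <-; elim: (j - i)%N => // k IH.
  by rewrite addSn; apply: subset_trans IH (Sle _).
apply: (dimA 3%N (fun i => Q i)) => i j ij; split.
  by move=> x /QP Six; apply/QP; apply: (mono i j) => //; apply: ltnW.
have [|x Sx nSx] := Slt i; first by apply: leq_trans ij _; rewrite -ltnS.
move=> sub; apply: nSx; apply/QP; apply: sub; apply/QP.
exact: (mono i.+1 j).
Qed.

Lemma zero_prime (A : idomainType) : is_prime [set (0 : A)].
Proof.
split; [split => //=|by move/eqP; rewrite oner_eq0|].
- by move=> x y -> ->; rewrite addr0.
- by move=> a x ->; rewrite mulr0.
- by move=> x y /= /eqP; rewrite mulf_eq0 => /orP [] /eqP; [left|right].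
Qed.

(** Otherwise [B] contains two algebraically independent elements [t] and [u].  A
prime [P1] of [B] maximal among those that avoid the nonzero polynomials in [t] is
nonzero because [u] is not algebraic over [t], and not maximal because [t] stays
transcendental modulo [P1], both by [Zariski_lemma].  Together with the kernel of
[pr], the zero ideal and a maximal ideal above [P1], this gives a chain of four
primes of [A]. *)
Lemma curve_algebraic (R : fieldType) (A B : idomainType) (c : {rmorphism R -> A})
    (ys : seq A) (pr : {rmorphism A -> B}) :
    krull_dim_le A 2 -> generates c ys -> (forall b, exists a, pr a = b) ->
    (exists2 x, x != 0 & pr x = 0) ->
  exists t, forall u, algebraic_over (ev (pr \o c) t) u.
Proof.
move=> dimA genA prsurj [x0 x00 prx0].
pose cB : {rmorphism R -> B} := pr \o c.
have genB : generates cB (map pr ys) by apply: generates_image.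
apply: contrapT => nt.
have nalg t : exists u, ~ algebraic_over (ev cB t) u.
  by apply: contrapT => nu; apply: nt; exists t => u; apply: contrapT => nau; apply: nu; exists u.
have [t nt0] := nalg 0; have [u nu] := nalg t.
have inj_ev p : p != 0 -> ev cB t p != 0.
  move=> p0; apply: contra_notN nt0 => /eqP pt.
  exists (map_poly polyC p); rewrite evE -map_poly_comp.
  have E : map_poly (ev cB 0 \o polyC) p = map_poly cB p.
    by apply: eq_map_poly => a /=; rewrite evC.
  by rewrite E map_poly_eq0.
pose M := [set m | exists2 q, q != 0 & m = ev cB t q].
have [||| P1 [P1prime _ P1M P1max]] :=
    @prime_avoiding B [set 0] M (prime_ideal (zero_prime B)).
- by exists 1; rewrite ?oner_neq0 ?rmorph1.
- move=> _ _ [p p0 ->] [q q0 ->]; exists (p * q); first by rewrite mulf_neq0.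
  by rewrite rmorphM.
- by move=> _ -> [q /inj_ev /eqP nq] /esym.
have P1nz : exists2 b, b != 0 & P1 b.
  apply: contrapT => P10; apply: nu.
  apply: (@Zariski_lemma _ _ (ev cB t) (map pr ys) 1 _ _ (oner_neq0 B)).
  - move=> p q pq; apply/eqP; rewrite -subr_eq0; apply: contraT => /inj_ev.
    by rewrite rmorphB pq subrr eqxx.
  - exact: generates_ev.
  move=> b b0; have [|a [_ [[q q0 ->] Pab]]] := P1max b.
    by move=> P1b; apply: P10; exists b.
  exists a, 0%N, q; split=> //; rewrite mul1r mulrC; apply/eqP.
  by rewrite -subr_eq0; apply: contra_notT P10 => nz; exists (a * b - ev cB t q).
have [||| P2 [P2prime P12 _ P2max]] :=
    @prime_avoiding B P1 [set 1] (prime_ideal P1prime).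
- by [].
- by move=> _ _ -> ->; rewrite mulr1.
- by move=> b P1b b1; apply: (prime1 P1prime); rewrite -b1.
have P2P1 : exists2 b, P2 b & ~ P1 b.
  apply: contrapT => P21.
  have {}P21 b : P2 b -> P1 b.
    by move=> P2b; apply: contrapT => nP1b; apply: P21; exists b.
  have [T [q [qsurj qker]]] := prime_quotient P1prime.
  have [|||p [p0 pt]] := @Zariski_lemma R T (q \o cB) (map q (map pr ys)) 1 _ _ (oner_neq0 T) _ (q t).
  - exact: fmorph_inj.
  - exact: generates_image qsurj genB.
  - move=> z z0; have [b qb] := qsurj z.
    have [|a [_ [-> Pa]]] := P2max b.
      by move=> /P21 /qker; rewrite qb => /eqP; rewrite (negPf z0).
    exists (q a), 0%N, 1; rewrite oner_neq0 rmorph1 mulr1; split=> //.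
    rewrite -qb -rmorphM mulrC expr0; apply/eqP; rewrite -subr_eq0 -(rmorph1 q) -rmorphB.
    by apply/eqP/qker/P21.
  have pn0 : p != 0 by apply: contraNneq p0 => ->; rewrite rmorph0.
  apply: (P1M (ev cB t p)); last by exists p.
  by apply/qker; rewrite -pt !evE -horner_map -map_poly_comp.
pose S i := nth (pr @^-1` P2) [:: [set 0]; [set a | pr a = 0]; pr @^-1` P1] i.
apply: (@no_prime_chain A S) => //.
- move=> [|[|[|i]]]; rewrite /S /= ?nth_nil; [exact: zero_prime| |exact: prime_preimage|exact: prime_preimage].
  exact: (prime_preimage pr (zero_prime B)).
- move=> [|[|[|i]]]; rewrite /S /= ?nth_nil => a //=.
  + by move=> ->; rewrite rmorph0.
  + by move=> ->; apply: (ideal0 (prime_ideal P1prime)).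
  + exact: P12.
- move=> [|[|[|i]]] //= _; rewrite /S /=.
  + by exists x0 => //; apply/eqP.
  + by have [b /eqP b0 P1b] := P1nz; have [a ab] := prsurj b; exists a; rewrite /= ab.
  + by have [b P2b nP1b] := P2P1; have [a ab] := prsurj b; exists a; rewrite /= ab.
Qed.

(** * Principal neighbourhoods *)

(** The relation makes [f1] positive wherever [f0] is, up to the error [g] that
vanishes at [alpha]; the correction by [h] confines the neighbourhood to the
points where the error is too small to matter. *)
Lemma pos_at_eliminate (A : comNzRingType) (alpha : specr A) (f0 f1 d s t g : A) :
    (forall beta : specr A, cone_of beta s) -> (forall beta : specr A, cone_of beta t) ->
    pos_at f0 alpha -> pos_at f1 alpha -> ~ supp alpha d -> supp alpha g ->
    d ^+ 2 * f1 = s + t * f0 + g ->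
  exists e h, [/\ ~ supp alpha e, supp alpha h, pos_at (f0 * e ^+ 2 - h ^+ 2) alpha &
    forall beta, pos_at (f0 * e ^+ 2 - h ^+ 2) beta -> pos_at f0 beta /\ pos_at f1 beta].
Proof.
move=> Ps Pt pf0 pf1 nd sg E.
have sid := supp_ideal alpha; have spr := supp_prime alpha.
pose e := s + t * f0; pose h := (1 + f0) * g.
have sh : supp alpha h by apply: idealM.
have ne : ~ supp alpha e.
  move=> se; have : supp alpha (d * (d * f1)).
    by rewrite mulrA -expr2 E; apply: idealD.
  by case/(primeM spr) => // /(primeM spr) [//|]; apply: pos_at_notin_supp pf1.
exists e, h; split=> //.
  apply: pos_at_congr (pos_at_sqr_mul pf0 ne) _.
  rewrite (_ : _ - _ = - h * h); last by ring.
  exact: idealM.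
by move=> beta; apply: pos_at_dominates E.
Qed.

(** Modulo the support of [alpha], the vectors of [Tsen] are orthogonal for the form
[<f1, f2, f1 f2>] and have the same value [F], so that this form is isometric to
[<F, F, 1>] and represents [f1] and [f2] as a square plus [F] times a sum of
squares.  The value [F] is positive at [alpha], where the form is positive
definite.  Thus [F > 0] implies that [f1] and [f2] are positive modulo the support,
and [pos_at_eliminate] extends this to a neighbourhood. *)
Lemma pos_at_pair (R : rcfType) (A : idomainType) (c : {rmorphism R -> A})
    (ys : seq A) (alpha : specr A) (f1 f2 : A) :
    krull_dim_le A 2 -> generates c ys -> (exists2 x, x != 0 & supp alpha x) ->
    pos_at f1 alpha -> pos_at f2 alpha ->
  exists f, pos_at f alpha /\
    forall beta, pos_at f beta -> pos_at f1 beta /\ pos_at f2 beta.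
Proof.
move=> dimA genA [x0 x00 sx0] pf1 pf2.
have sid := supp_ideal alpha; have spr := supp_prime alpha.
have [B [pr [prsurj prker]]] := prime_quotient spr.
have [|t alg] := curve_algebraic dimA genA prsurj; first by exists x0 => //; apply/prker.
have genB : generates (pr \o c) (map pr ys) by apply: generates_image.
pose q := [:: f1; f2; f1 * f2].
have [u [v [[l0 uv0] quv buv]]] := Tsen (fun l : 'I_3 => pr q`_l) genB alg.
have [U UP] := choice (fun l => prsurj (u l)).
have [V VP] := choice (fun l => prsurj (v l)).
pose Q (W : 'I_3 -> A) := \sum_(l < 3) q`_l * (W l * W l).
have sQ : supp alpha (Q V - Q U).
  apply/prker; rewrite rmorphB /Q !rmorph_sum; apply/eqP; rewrite subr_eq0; apply/eqP.
  transitivity (\sum_(l < 3) pr q`_l * (v l * v l)).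
    by apply: eq_bigr => l _; rewrite !rmorphM VP.
  by rewrite -quv; apply: eq_bigr => l _; rewrite !rmorphM UP.
have sb : supp alpha (\sum_(l < 3) q`_l * (U l * V l)).
  apply/prker; rewrite rmorph_sum -[RHS]buv.
  by apply: eq_bigr => l _; rewrite !rmorphM UP VP.
have pq (l : 'I_3) : pos_at q`_l alpha.
  case: l => -[|[|[|l]]] //= _; split; first by apply: coneM; [case: pf1|case: pf2].
  by case/(primeM spr); apply: pos_at_notin_supp.
have posQ (W : 'I_3 -> A) (l : 'I_3) : ~ supp alpha (W l) -> pos_at (Q W) alpha.
  move=> nW; have : pos_at (q`_l * W l ^+ 2) alpha by apply: pos_at_sqr_mul.
  move=> /pos_atP n; apply/pos_atP => PN; apply: n.
  rewrite (_ : - _ = - Q W + \sum_(i < 3 | i != l) q`_i * (W i * W i)); last first.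
    by rewrite /Q (bigD1 l) //= expr2; ring.
  apply: coneD => //; apply: (big_ind (cone_of alpha)).
  - exact: cone0.
  - exact: coneD.
  - move=> i _; apply: coneM; first by case: (pq i).
    by rewrite -expr2; apply: coneX.
have pF : pos_at (Q U) alpha.
  case: uv0 => w0.
    by apply: (posQ U l0) => /prker; rewrite UP => /eqP; rewrite (negPf w0).
  have pV : pos_at (Q V) alpha.
    by apply: (posQ V l0) => /prker; rewrite VP => /eqP; rewrite (negPf w0).
  apply: pos_at_congr pV _; rewrite -opprB -mulN1r; exact: idealM.
move: sQ sb pF; rewrite /Q !big_ord_recl !big_ord0 !addr0 /=.
set u1 := U ord0; set u2 := U (lift _ _); set u3 := U (lift _ _).
set v1 := V ord0; set v2 := V (lift _ _); set v3 := V (lift _ _).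
rewrite !addrA; set F := f1 * (u1 * u1) + _ + _; set D := _ - F.
set b := f1 * (u1 * v1) + _ + _ => sD sb pF.
(* The Gram determinant of the last two coordinates gives the square s1, that of
   the first and third the square s2. *)
pose s1 := (f1 * f2 * (u2 * v3 - u3 * v2)) ^+ 2; pose t1 := f1 ^+ 2 * (u1 ^+ 2 + v1 ^+ 2).
pose s2 := (f1 * f2 * (u1 * v3 - u3 * v1)) ^+ 2; pose t2 := f2 ^+ 2 * (u2 ^+ 2 + v2 ^+ 2).
pose g1 := - f1 * (F - f1 * u1 ^+ 2) * D + (f1 * b - (1 + 1) * f1 ^+ 2 * u1 * v1) * b.
pose g2 := - f2 * (F - f2 * u2 ^+ 2) * D + (f2 * b - (1 + 1) * f2 ^+ 2 * u2 * v2) * b.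
have E1 : F ^+ 2 * f1 = s1 + t1 * F + g1 by rewrite /s1 /t1 /g1 /D /b /F; ring.
have E2 : F ^+ 2 * f2 = s2 + t2 * F + g2 by rewrite /s2 /t2 /g2 /D /b /F; ring.
have sg1 : supp alpha g1 by apply: idealD => //; apply: idealM.
have sg2 : supp alpha g2 by apply: idealD => //; apply: idealM.
have Ps1 beta : cone_of beta s1 by apply: coneX.
have Ps2 beta : cone_of beta s2 by apply: coneX.
have Pt1 beta : cone_of beta t1 by apply: coneM; [|apply: coneD]; apply: coneX.
have Pt2 beta : cone_of beta t2 by apply: coneM; [|apply: coneD]; apply: coneX.
have nF := pos_at_notin_supp pF.
have [e [h [ne sh pf' f'P]]] := pos_at_eliminate Ps1 Pt1 pF pf1 nF sg1 E1.
set f' := F * _ - _ in pf' f'P.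
have nFe : ~ supp alpha (F * e) by case/(primeM spr).
(* f' is F * e ^+ 2 up to the support, so the relation for f2 can be rewritten in
   terms of f' instead of F. *)
have E2' : (F * e) ^+ 2 * f2 = e ^+ 2 * s2 + t2 * f' + (t2 * h * h + e ^+ 2 * g2).
  by rewrite exprMn mulrAC E2 /f'; ring.
have sg2' : supp alpha (t2 * h * h + e ^+ 2 * g2) by apply: idealD => //; apply: idealM.
have Ps2' beta : cone_of beta (e ^+ 2 * s2) by apply: coneM => //; apply: coneX.
have [e' [h' [_ _ pf'' f''P]]] := pos_at_eliminate Ps2' Pt2 pf' pf2 nFe sg2' E2'.
exists (f' * e' ^+ 2 - h' ^+ 2); split=> // beta /f''P [/f'P [_ pf1b] pf2b].
by split.
Qed.

Lemma pos_at_principal (R : rcfType) (A : idomainType) (c : {rmorphism R -> A})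
    (ys : seq A) (alpha : specr A) (fs : seq A) :
    krull_dim_le A 2 -> generates c ys -> (exists2 x, x != 0 & supp alpha x) ->
    basic_open fs alpha ->
  exists f, pos_at f alpha /\ forall beta, pos_at f beta -> basic_open fs beta.
Proof.
move=> dimA genA snz; elim: fs => [|f fs IH] pfs.
  by exists 1; split=> // ; apply: pos_at1.
have [|f' [pf' f'P]] := IH; first by move=> g gfs; apply: pfs; rewrite inE gfs orbT.
have [|f'' [pf'' f''P]] := pos_at_pair dimA genA snz (pfs f _) pf'.
  exact: mem_head.
exists f''; split=> // beta /f''P [pf /f'P pfsb] g.
by rewrite inE => /predU1P [->//|]; apply: pfsb.
Qed.

(** * Central and precentral orderings *)

(** If [a] is a sum of squares in the fraction field but negative at [alpha], the
neighbourhood where [a] is negative contains no ordering of that field. *)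
Lemma spec_c_sub_spec_pc (A : idomainType) : spec_c A `<=` spec_pc A.
Proof.
move=> alpha calpha a /= Sa; apply: contrapT => nPa.
have pNa : pos_at (- a) alpha by apply/pos_atP; rewrite opprK.
have [|_ [[Q _ <-] /(_ (- a) (mem_head _ _)) /pos_atP]] := calpha (basic_open [:: - a]).
  apply: open_nbhs_nbhs; split; first exact: open_basic_open.
  by move=> f; rewrite inE => /eqP ->.
apply; rewrite opprK /=; apply: sums_of_squares_cone Sa.
by have [[]] := cone_ofP Q.
Qed.

Lemma supp_field (F : fieldType) (Q : specr F) x : supp Q x -> x = 0.
Proof.
move=> [Px PNx]; apply: contrapT => /eqP x0; apply: (@coneN1 _ Q).
rewrite (_ : - 1 = x * (- x) * x^-1 ^+ 2); last by field.
by apply: coneM; [apply: coneM|apply: coneX].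
Qed.

Lemma specr_eq (B : comNzRingType) (alpha beta : specr B) :
  cone_of alpha = cone_of beta -> alpha = beta.
Proof.
case: alpha beta => P Pord [Q Qord] /= PQ; case: _ / PQ in Qord *.
by rewrite (Prop_irrelevance Pord Qord).
Qed.

Lemma fraction_quotient (A : idomainType) (z : {fraction A}) :
  exists a d, d != 0 /\ z * tofrac d = tofrac a.
Proof.
pose r := repr z; exists (frac r).1, (frac r).2; split; first exact: denom_ratioP.
rewrite -[z]reprK -/r; unlock tofrac.
rewrite -[LHS]FracField.pi_mul; apply/eqmodP => /=; rewrite FracField.equivfE.
rewrite /FracField.mulf !numden_Ratio ?mulr1 ?oner_neq0 ?mulf_neq0 ?oner_neq0 ?denom_ratioP //.
by rewrite mulrC.
Qed.

Lemma frac_inverse (A : idomainType) (x : {fraction A}) : x != 0 -> exists y, x * y = 1.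
Proof. by move=> x0; exists x^-1; rewrite divff. Qed.

(** If no ordering of the fraction field made [f] positive, [- f] would be a sum of
squares there, hence nonnegative at the precentral [alpha]. *)
Lemma pos_at_contraction (A : idomainType) (alpha : specr A) (f : A) :
  spec_pc A alpha -> pos_at f alpha -> exists Q, pos_at f (contraction Q).
Proof.
move=> pca pf; set x : {fraction A} := tofrac f.
have x0 : x != 0.
  rewrite tofrac_eq0; apply/eqP => f0; apply: (pos_at_notin_supp pf).
  by rewrite f0; apply: ideal0 (supp_ideal alpha).
have nS : ~ sums_of_squares (- x).
  rewrite /x -rmorphN => /pca PNf; move/pos_atP: pf; exact.
have [SD SM SX] := sums_of_squares_is_cone {fraction A}.
have S0 : sums_of_squares (0 : {fraction A}) by exists [::]; rewrite big_nil.
have S1 : sums_of_squares (1 : {fraction A}) by have := SX 1; rewrite expr1n.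
pose T := [set z : {fraction A} | exists s t,
  [/\ sums_of_squares s, sums_of_squares t & z = s + t * x]].
have [|Q TQ] := @ordering_extending_cone {fraction A} T _ (@frac_inverse A).
  split; [split|].
  - move=> _ _ [s [t [Ss St ->]]] [s' [t' [Ss' St' ->]]].
    by exists (s + s'), (t + t'); split; [exact: SD|exact: SD|ring].
  - move=> _ _ [s [t [Ss St ->]]] [s' [t' [Ss' St' ->]]].
    exists (s * s' + x ^+ 2 * (t * t')), (s * t' + t * s'); split; last by ring.
      by apply: (SD); [apply: SM|apply: (SM); [apply: SX|apply: SM]].
    by apply: (SD); apply: SM.
  - by move=> b; exists (b ^+ 2), 0; rewrite mul0r addr0.
  move=> [s [t [Ss St E]]]; apply: nS.
  have [t0|t0] := eqVneq t 0.
    case: (@coneN1 _ alpha); apply: pca; rewrite /= rmorphN rmorph1.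
    by rewrite E t0 mul0r addr0.
  rewrite (_ : - x = (1 + s) * t * t^-1 ^+ 2).
    by apply: (SM) => //; apply: (SM) => //; apply: SD.
  have -> : 1 + s = - (t * x) by rewrite -[1]opprK E; ring.
  by field.
exists Q; split=> /=; first by apply: TQ; exists 0, 1; rewrite mul1r add0r.
move=> [Px PNx]; rewrite /= rmorphN in PNx.
by move/eqP: x0; apply; apply: (@supp_field _ Q).
Qed.

(** The elements of the fraction field that become nonnegative at [alpha] after
multiplication by a square form a proper cone. *)
Lemma range_contraction_support0 (A : idomainType) (alpha : specr A) :
  (forall x, supp alpha x -> x = 0) -> range (@contraction A) alpha.
Proof.
move=> s0.
pose T := [set z : {fraction A} | exists a d,
  [/\ d != 0, cone_of alpha a & z * tofrac d ^+ 2 = tofrac a]].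
have PT a : cone_of alpha a -> T (tofrac a).
  by move=> Pa; exists a, 1; rewrite oner_neq0 rmorph1 expr1n mulr1.
have [|Q TQ] := @ordering_extending_cone {fraction A} T _ (@frac_inverse A).
  split; [split|].
  - move=> z w [a [d [d0 Pa Ez]]] [b [e [e0 Pb Ew]]].
    exists (a * e ^+ 2 + b * d ^+ 2), (d * e); split; first by rewrite mulf_neq0.
      by apply: coneD; apply: coneM => //; apply: coneX.
    by rewrite tofracD (tofracM a) (tofracM b) (tofracM d e) !tofracXn -Ez -Ew; ring.
  - move=> z w [a [d [d0 Pa Ez]]] [b [e [e0 Pb Ew]]].
    exists (a * b), (d * e); split; [by rewrite mulf_neq0|exact: coneM|].
    by rewrite !tofracM -Ez -Ew; ring.
  - move=> z; have [a [d [d0 Ez]]] := fraction_quotient z.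
    exists (a ^+ 2), d; split=> //; first exact: coneX.
    by rewrite tofracXn -Ez exprMn.
  move=> [a [d [d0 Pa E]]]; have : d ^+ 2 = 0.
    apply: s0; split; first exact: coneX.
    suff -> : - d ^+ 2 = a by [].
    by apply/eqP; rewrite -tofrac_eq -E rmorphN rmorphXn mulN1r.
  by move/eqP; rewrite expf_eq0 /= (negPf d0).
exists Q => //; apply: specr_eq; apply/seteqP; split=> a Qa; last exact/TQ/PT.
apply: contrapT => nPa.
have PNa : cone_of alpha (- a) by case: (cone_total alpha a).
case: nPa; suff -> : a = 0 by apply: (cone0 alpha).
apply/eqP; rewrite -tofrac_eq0; apply/eqP/(@supp_field _ Q); split=> //.
by rewrite -tofracN; apply/TQ/PT.
Qed.

Lemma spec_pc_eq_spec_c (R : rcfType) (A : idomainType) (c : {rmorphism R -> A})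
    (ys : seq A) :
  krull_dim_le A 2 -> generates c ys -> spec_pc A = spec_c A.
Proof.
move=> dimA genA; apply/seteqP; split; last exact: spec_c_sub_spec_pc.
move=> alpha pca; have [snz|s0] := pselect (exists2 x, x != 0 & supp alpha x); last first.
  apply: subset_closure; apply: range_contraction_support0 => x sx.
  by apply: contrapT => /eqP x0; apply: s0; exists x.
move=> U /nbhs_basic_open [fs [fsa fsU]].
have [f [pf fP]] := pos_at_principal dimA genA snz fsa.
have [Q pQ] := pos_at_contraction pca pf.
by exists (contraction Q); split; [exists Q|apply/fsU/fP].
Qed.

Theorem corollary4p7 (R : rcfType) (n : nat) (I : prime_idealr {mpoly R[n]})
    (hreal : formally_real {fraction (coord_ring I)})
    (hdim : krull_dim_le (coord_ring I) 2) :
  spec_pc (coord_ring I) = spec_c (coord_ring I).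
Proof.
pose pr : {rmorphism {mpoly R[n]} -> coord_ring I} := (\pi_({ideal_quot I}))%qT.
pose c : {rmorphism R -> coord_ring I} := pr \o @mpolyC n R.
apply: (@spec_pc_eq_spec_c R _ c (map pr [seq 'X_i | i : 'I_n])) => //.
apply: generates_image (@mpoly_generates R n) => x.
by exists (repr x); apply: reprK.
Qed.
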